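(* Let $(\mathbb T,g)$ be a minimal rotation on an infinite compact metrisable monothetic group $\mathbb T$ with normalised Haar measure $m$. There are separating covers $W,W'$ of $\mathbb T$ with $m(\partial W)>0$ and $m(\partial W')>0$ such that $S_{\partial W}$ is maximal, that is, $S_{\partial W}=[0,m(\partial W)]$, and such that $S_{\partial W'}$ is not maximal, that is, $S_{\partial W'}\ne[0,m(\partial W')]$. In fact, whenever $W$ is a separating cover of $\mathbb T$ such that the associated almost automorphic subshift $(\Sigma_W,\sigma)$ is an (irregular) almost $1$-to-$1$ extension of $(\mathbb T,g)$ all of whose fibres have at most $2$ elements, then $S_{\partial W}$ is maximal, that is, $S_{\partial W}=[0,m(\partial W)]$.
   Context: $\mathbb T$ is monothetic if it has a dense cyclic subgroup; $(\mathbb T,g)$ denotes the rotation $\theta\mapsto\theta+g$, which is minimal if all orbits are dense. For $C\subseteq\mathbb T$, $S_C=\bigcup_{\theta\in\mathbb T}\{\nu\in[0,1]\colon\nu\text{ is an accumulation point of the sequence }\frac1n\sum_{i=0}^{n-1}\mathbf 1_C(\theta+ig)\}$, where accumulation points of the sequence are the elements of $\bigcap_{N\in\mathbb N}\overline{\{\frac1n\sum_{i=0}^{n-1}\mathbf 1_C(\theta+ig)\colon n\ge N\}}$. A separating cover of $\mathbb T$ is a finite collection $W=(W_0,\ldots,W_{p-1})$ of subsets of $\mathbb T$ such that (a) $\mathbb T=\bigcup_iW_i$ and $\operatorname{int}W_i\cap\operatorname{int}W_j=\emptyset$ for $i\ne j$; (b) $\overline{\operatorname{int}W_i}=W_i$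 for all $i$; (c) for all $\theta\ne\theta'$ in $\mathbb T$ there are $i\ne j$ and $n\in\mathbb Z$ with $\theta+ng\in\operatorname{int}W_i$ and $\theta'+ng\in\operatorname{int}W_j$. Set $\partial W=\bigcup_i\partial W_i$. The almost automorphic subshift associated with a separating cover $W$ is the minimal subshift $\Sigma_W\subseteq\{0,\ldots,p-1\}^{\mathbb Z}$ (with left shift $\sigma$) given as the closure of all sequences $(x_n)_{n\in\mathbb Z}$ for which there is $\theta\in\mathbb T$ with $\theta+ng\in\operatorname{int}W_{x_n}$ for all $n\in\mathbb Z$. It comes with an almost $1$-to-$1$ factor map $\pi\colon(\Sigma_W,\sigma)\to(\mathbb T,g)$ (continuous surjection intertwining $\sigma$ and the rotation, with at least one singleton fibre), characterised by $\pi(x)+ng\in W_{x_n}$ for all $n\in\mathbb Z$, and it satisfies $W_i=\{\theta\in\mathbb T\colon\text{there is }x\in\pi^{-1}\theta\text{ with }x_0=i\}$. The extension is irregular if the set of $\theta$ with singleton fibre is $m$-null, equivalently if $m(\partial W)>0$. *)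

(* Defs.v *)
From HB Require Import structures.
From mathcomp Require Import all_boot all_order all_algebra.
From mathcomp Require Import all_classical all_reals all_analysis.

Set Implicit Arguments.
Unset Strict Implicit.
Unset Printing Implicit Defensive.

Import Order.TTheory GRing.Theory Num.Theory.
Import numFieldNormedType.Exports.

Local Open Scope classical_set_scope.
Local Open Scope ring_scope.

Definition metrizable (R : realType) (T : topologicalType) : Prop :=
  exists d : T -> T -> R,
    [/\ forall x y, d x y = 0 <-> x = y,
        forall x y, d x y = d y x,
        forall x y z, d x z <= d x y + d y z &
        forall x, nbhs x =
          filter_from [set e | 0 < e] (fun e => [set y | d x y < e])].

(* The carrier of T with its Borel sigma-algebra. The library wants measurable
   types to be pointed, which a topologicalZmodType is not by itself: the
   point is taken to be 0. *)
Definition borel (T : topologicalZmodType) : Type := T.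

HB.instance Definition _ (T : topologicalZmodType) := Choice.on (borel T).
HB.instance Definition _ (T : topologicalZmodType) :=
  isPointed.Build (borel T) (0 : T).
HB.instance Definition _ (T : topologicalZmodType) :=
  @isMeasurable.Build (sigma_display (@open T)) (borel T)
    <<s @open T >> (@sigma_algebra0 _ setT (@open T))
    (@sigma_algebraC (borel T) (@open T))
    (@sigma_algebra_bigcup _ setT (@open T)).

(* Regularity is automatic for Borel probabilities on a compact metrizable
   space, so that it is not part of the definition. *)
Definition normalized_haar (R : realType) (T : topologicalZmodType)
    (m : probability (borel T) R) : Prop :=
  forall (t : T) (A : set (borel T)), measurable A ->
    m [set t + x | x in (A : set T)] = m A.

Definition monothetic (T : topologicalZmodType) : Prop :=
  exists h : T, dense (range (fun n : int => h *~ n)).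

Definition minimal_rotation (T : topologicalZmodType) (g : T) : Prop :=
  forall theta : T, dense (range (fun n : int => theta + g *~ n)).

Definition boundary (T : topologicalType) (A : set T) : set T :=
  closure A `\` A°.

Section Averages.
Context {R : realType} {T : topologicalZmodType}.
Implicit Types (g theta : T) (C : set T).

Definition visit_average g C theta (n : nat) : R :=
  n%:R^-1 * \sum_(i < n) \1_C (theta + g *+ i).

Definition accumulation_points (u : R^nat) : set R :=
  \bigcap_N closure [set u n | n in [set n | (N <= n)%N]].

Definition visit_frequencies g C : set R :=
  \bigcup_theta
    [set nu | 0 <= nu <= 1 /\ accumulation_points (visit_average g C theta) nu].

Definition maximal_frequencies g C (m : probability (borel T) R) : Prop :=
  visit_frequencies g C = `[0, fine (m C)]%classic.

End Averages.

Section Covers.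
Context {T : topologicalZmodType} (g : T) {p : nat}.
Implicit Type W : 'I_p -> set T.

Definition separating_cover W : Prop :=
  [/\ \bigcup_i W i = setT,
      forall i j, i != j -> (W i)° `&` (W j)° = set0,
      forall i, regclosed (W i) &
      forall theta theta' : T, theta != theta' ->
        exists i j (n : int),
          [/\ i != j, (W i)° (theta + g *~ n) & (W j)° (theta' + g *~ n)]].

Definition cover_boundary W : set T := \bigcup_i boundary (W i).

Definition symbolic_space := {ptws int -> discrete_topology 'I_p}.

Definition left_shift (x : symbolic_space) : symbolic_space :=
  fun n => x (n + 1).

Definition generic_itineraries W : set symbolic_space :=
  [set x | exists theta : T, forall n : int, (W (x n))° (theta + g *~ n)].

Definition almost_automorphic_subshift W : set symbolic_space :=
  closure (generic_itineraries W).

Definition fibre W (pi : symbolic_space -> T) (theta : T) :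
    set symbolic_space :=
  [set x | almost_automorphic_subshift W x /\ pi x = theta].

(* Only the values of pi on the subshift of W matter. *)
Definition almost_1to1_factor_map W (pi : symbolic_space -> T) : Prop :=
  [/\ {within almost_automorphic_subshift W, continuous pi},
      pi @` almost_automorphic_subshift W = setT,
      forall x, almost_automorphic_subshift W x ->
        pi (left_shift x) = pi x + g,
      exists theta x, fibre W pi theta = [set x] &
      forall x, almost_automorphic_subshift W x ->
        forall n : int, W (x n) (pi x + g *~ n)].

End Covers.
Arguments symbolic_space : clear implicits.

(* Main.v *)
Require Import Defs.
From mathcomp Require Import all_boot all_order all_algebra.
From mathcomp Require Import all_classical all_reals all_analysis.
From mathcomp Require Import measurable_realfun random_variable.
From mathcomp Require Import ring lra zify.

(** Notation: A_n(C, t) is the proportion of visits to C among the first n points of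
the orbit of t, and m is the Haar measure.

For closed D, the averages A_n(D, t) are eventually at most m(D) + e,
uniformly in t ([visit_upper_bound]): by minimality every orbit follows any
other one up to a bounded delay and a small translation, so that A_n(D, t) is
essentially bounded by A_n(O, s) for a slightly larger open set O and all s;
integrating over s gives m(O). Since A_n(D, .) has mean m(D), it is then close to
m(D) off a set of small measure ([visit_average_in_measure]); this takes the place
of an ergodic theorem. Consequently all frequencies of visits to D lie in [0, m(D)],
and, as consecutive averages differ by at most 1/n, one orbit whose averages come
close to 0 and to m(D) again and again realises all of them
([oscillation_maximal]).

Now let C be the boundary of a cover with fibres of at most two points. The point
t + ng lies in C if and only if two elements of the fibre over t differ at time
n. If there are at most two, then C meets each of its translates by ng in a
relatively clopen subset of C ([closed_boundary_trace]), and this suffices for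
maximality ([clopen_trace_maximal]). One constructs nested relatively clopen
subsets of C of positive measure on which some late average is alternately close
to m(C) and to 0. The former is possible by convergence in measure. For the
latter, in a set V of positive measure the points whose orbits do not come back to
V for a given time L still have positive measure, because every orbit spends
stretches of time L outside C; and while an orbit stays away from V it visits C
rarely, since the part of C that does not come back to V in bounded time is closed
and of small measure.

For the existence of covers, one may prescribe the boundary: a nonempty closed
nowhere dense set C is the boundary of a separating cover by two sets, up to a
null set that no orbit visits with positive frequency ([exists_cover_with_boundary]).
One of the two sets is the closure of a union of tiny islands that cluster exactly
at C. Their sizes decrease so fast and their positions are so generic that no
translation other than the identity maps islands to islands, which yields the
separation property, and that orbits meet their shores very rarely. It remains to
find suitable sets C of positive measure.

A maximal set ([exists_maximal_set]) is obtained by removing from the group narrow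
neighbourhoods of longer and longer stretches of the orbit of 0, where each stretch
begins only after the averages along this orbit have recovered from the previous
ones.

A set which is not maximal ([exists_non_maximal_set]) is C = {w_0 + w_1 + ... <= 1},
where w_j is greater than 1 on a small ball around jg, has small averages in the long
run, and has averages at most 7 w_j(t) along the orbit of t at all times.
If the sum of the weights converges at t, then its tail contributes little to the
averages along the orbit of t at all times, and its other terms contribute little
in the long run. So an orbit that visits C does so at least half of the time in
the long run, and no frequency lies strictly between 0 and 1/2. *)

Set Implicit Arguments.
Unset Strict Implicit.
Unset Printing Implicit Defensive.

Import Order.TTheory GRing.Theory Num.Theory.
Import numFieldNormedType.Exports.

Local Open Scope classical_set_scope.
Local Open Scope ring_scope.

(** * Real-valued mass of Borel sets *)

Section Mass.
Context {R : realType} {T : topologicalZmodType} (m : probability (borel T) R).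
Implicit Types A B : set T.

Definition borel_set A : Prop := measurable (A : set (borel T)).

Definition mass A : R := fine (m A).

Lemma open_borel A : open A -> borel_set A.
Proof. by move=> oA; apply: sub_sigma_algebra. Qed.

Lemma closed_borel A : closed A -> borel_set A.
Proof.
move=> cA; rewrite /borel_set -[A]setCK; apply: measurableC.
by apply: open_borel; exact: closed_openC.
Qed.

Lemma massE A : borel_set A -> m A = (mass A)%:E.
Proof. by move=> mA; rewrite /mass fineK// fin_num_measure. Qed.

Lemma mass_lty A : borel_set A -> (m A < +oo)%E.
Proof. by move=> mA; rewrite ltey_eq fin_num_measure. Qed.

Lemma mass_ge0 A : 0 <= mass A.
Proof. by rewrite /mass fine_ge0. Qed.

Lemma massT : mass setT = 1.
Proof. by rewrite /mass probability_setT. Qed.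

Lemma mass0 : mass set0 = 0.
Proof. by rewrite /mass measure0. Qed.

Lemma mass_mono A B : borel_set A -> borel_set B -> A `<=` B -> mass A <= mass B.
Proof.
move=> mA mB AB; rewrite -lee_fin -!massE//.
by apply: le_measure => //; rewrite inE.
Qed.

Lemma mass_le1 A : borel_set A -> mass A <= 1.
Proof. by move=> mA; rewrite -massT; apply: mass_mono => //; exact: measurableT. Qed.

Lemma massU_le A B : borel_set A -> borel_set B -> mass (A `|` B) <= mass A + mass B.
Proof.
move=> mA mB; rewrite -lee_fin EFinD -!massE//; last exact: measurableU.
exact: measureU2.
Qed.

Lemma massC A : borel_set A -> mass (~` A) = 1 - mass A.
Proof.
move=> mA; apply: EFin_inj; rewrite EFinB -!massE//; last exact: measurableC.
exact: probability_setC.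
Qed.

Lemma mass_bigcup_le (F : nat -> set T) (a : R) :
  (forall n, borel_set (F n)) -> (forall n, \sum_(i < n) mass (F i) <= a) ->
  mass (\bigcup_n F n) <= a.
Proof.
move=> mF Fa; rewrite -lee_fin -massE; last first.
  by apply: bigcup_measurable => k _; exact: mF.
apply: (@le_trans _ _ (\sum_(0 <= i <oo) m (F i))%E).
  by apply: measure_sigma_subadditive => //; apply: bigcup_measurable => k _; exact: mF.
apply: lime_le; first exact: is_cvg_nneseries.
apply: nearW => n; rewrite big_mkord.
rewrite (eq_bigr (fun i : 'I_n => (mass (F i))%:E)); last by move=> i _; rewrite massE.
rewrite sumEFin lee_fin; exact: Fa.
Qed.

Lemma mass_bigcup0 (F : nat -> set T) :
  (forall n, borel_set (F n)) -> (forall n, mass (F n) = 0) ->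
  mass (\bigcup_n F n) = 0.
Proof.
move=> mF F0; apply/eqP; rewrite eq_le mass_ge0 andbT.
by apply: mass_bigcup_le => // n; rewrite big1// => i _; exact: F0.
Qed.

Lemma mass_gt0_nonempty A : 0 < mass A -> A !=set0.
Proof.
move=> mA; apply/set0P/eqP => A0.
by rewrite A0 mass0 ltxx in mA.
Qed.

Lemma mass_bigcap_cvg (F : nat -> set T) (e : R) : 0 < e ->
  (forall n, borel_set (F n)) -> (forall n, F n.+1 `<=` F n) ->
  \forall n \near \oo, mass (F n) < mass (\bigcap_n F n) + e.
Proof.
move=> e0 mF dF.
have ni : nonincreasing_seq F by apply/nonincreasing_seqP => n; exact/subsetPset.
have mI : borel_set (\bigcap_n F n) by apply: bigcap_measurable => // k _; exact: mF.
have F0 : (m (F 0%N) < +oo)%E by exact: mass_lty.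
have cF := @nonincreasing_cvg_mu _ _ _ m F F0 mF mI ni.
have {}cF : (m \o F) @ \oo --> (mass (\bigcap_n F n))%:E by rewrite -massE.
move/fine_cvgP : cF => [_ cF].
have := cvgr_lt _ cF; apply.
by rewrite ltrDl.
Qed.

Lemma measurable_sum_indic n (E : nat -> set T) (a : nat -> R) :
  (forall i, borel_set (E i)) ->
  measurable_fun [set: borel T]
    ((fun x => (\sum_(i < n) a i * \1_(E i) x)%:E) : borel T -> \bar R).
Proof.
move=> mE; apply/measurable_EFinP; apply: measurable_sum => i.
by apply: measurable_funM => //; apply: measurable_indic; exact: mE.
Qed.

Lemma integral_sum_indic n (E : nat -> set T) (a : nat -> R) :
  (forall i, borel_set (E i)) -> (forall i, 0 <= a i) ->
  (\int[m]_x ((\sum_(i < n) a i * \1_(E i) (x : T))%:E))%E =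
  (\sum_(i < n) a i * mass (E i))%:E.
Proof.
move=> mE a0.
under eq_integral do rewrite -sumEFin.
rewrite ge0_integral_sum//.
- rewrite -sumEFin; apply: eq_bigr => i _.
  under eq_integral do rewrite EFinM.
  rewrite ge0_integralZl//.
  + rewrite integral_indic//; last exact: mE.
    by rewrite setIT EFinM; congr (_ * _)%E; exact: massE.
  + by apply/measurable_EFinP; apply: measurable_indic; exact: mE.
  + by rewrite lee_fin.
- move=> i; apply/measurable_EFinP.
  by apply: measurable_funM => //; apply: measurable_indic; exact: mE.
- by move=> i x _; rewrite lee_fin mulr_ge0.
Qed.

(** Pointwise bounds on weighted counts of visits become bounds on masses by
integration; with [sum_mass_ge] this is the only use made of the integral. *)
Lemma sum_mass_le n (E : nat -> set T) (a : nat -> R) (b : R) :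
  (forall i, borel_set (E i)) -> (forall i, 0 <= a i) ->
  (forall x, \sum_(i < n) a i * \1_(E i) x <= b) ->
  \sum_(i < n) a i * mass (E i) <= b.
Proof.
move=> mE a0 Eb; have b0 : 0 <= b.
  by apply: le_trans (Eb 0); apply: sumr_ge0 => i _; rewrite mulr_ge0.
rewrite -lee_fin -integral_sum_indic//.
apply: (@le_trans _ _ (\int[m]_x (b%:E))%E); last first.
  by rewrite integral_cst//= probability_setT mule1.
apply: ge0_le_integral => //.
- by move=> x _; rewrite lee_fin; apply: sumr_ge0 => i _; rewrite mulr_ge0.
- exact: measurable_sum_indic.
- by move=> x _; rewrite lee_fin; exact: Eb.
Qed.

Lemma sum_mass_ge n (E : nat -> set T) (a : nat -> R) (b : R) :
  (forall i, borel_set (E i)) -> (forall i, 0 <= a i) -> 0 <= b ->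
  (forall x, b <= \sum_(i < n) a i * \1_(E i) x) ->
  b <= \sum_(i < n) a i * mass (E i).
Proof.
move=> mE a0 b0 Eb; rewrite -lee_fin -integral_sum_indic//.
apply: (@le_trans _ _ (\int[m]_x (b%:E))%E).
  by rewrite integral_cst//= probability_setT mule1.
apply: ge0_le_integral => //.
- exact: measurable_sum_indic.
- by move=> x _; rewrite lee_fin; exact: Eb.
Qed.

End Mass.

(** * Topology of the group and elementary facts on the rotation *)

Section GroupTopology.
Context {T : topologicalZmodType}.
Implicit Types (A O : set T) (x t : T).

Lemma shift_continuous t : continuous (fun x : T => x + t).
Proof.
move=> x; rewrite /continuous_at.
apply: (@continuous_comp _ _ _ (fun x => (x, t)) (fun z : T * T => z.1 + z.2)).
  by apply: cvg_pair => /=; [exact: cvg_id|exact: cvg_cst].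
exact: add_continuous.
Qed.

Lemma open_shift t O : open O -> open [set x | O (x + t)].
Proof. by move=> oO; apply: open_comp => // x _; exact: shift_continuous. Qed.

Lemma closed_shift t A : closed A -> closed [set x | A (x + t)].
Proof. by move=> cA; apply: closed_comp => // x _; exact: shift_continuous. Qed.

Lemma nbhs_shift x O : nbhs x O <-> nbhs 0 [set v | O (x + v)].
Proof.
split => Ox.
  have h : nbhs (0 : T) [set v | O (v + x)].
    by have := @shift_continuous x 0; rewrite /continuous_at add0r => /(_ _ Ox).
  by apply: filterS h => v /=; rewrite addrC.
have h : nbhs x [set v | O (x + (v - x))].
  by have := @shift_continuous (- x) x; rewrite /continuous_at subrr => /(_ _ Ox).
by apply: filterS h => v /=; rewrite addrC subrK.
Qed.

Lemma closure_shift t A :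
  closure [set x | A (x + t)] = [set x | closure A (x + t)].
Proof.
apply/seteqP; split.
  rewrite {2}/closure => x /= xA U xU.
  have := xA [set y | U (y + t)].
  case; last by move=> y [Ay Uy]; exists (y + t).
  exact: shift_continuous.
move=> x /= xA U xU.
have [] := xA [set y | U (y - t)].
  by apply: shift_continuous; rewrite addrK.
by move=> y [Ay Uy]; exists (y - t); split => //=; rewrite subrK.
Qed.

Lemma combination_continuous : continuous (fun z : T * T * T => z.1.1 + z.1.2 - z.2).
Proof.
move=> z; apply: (@continuous_comp _ _ _
  (fun z : T * T * T => (z.1.1 + z.1.2, z.2)) (fun z : T * T => z.1 - z.2)).
  apply: cvg_pair => /=; last exact: cvg_snd.
  apply: (@continuous_comp _ _ _ fst (fun z : T * T => z.1 + z.2)).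
    exact: cvg_fst.
  exact: add_continuous.
exact: sub_continuous.
Qed.

Lemma nbhs0_combination O : nbhs 0 O ->
  exists U, nbhs 0 U /\ forall u v w, U u -> U v -> U w -> O (u + v - w).
Proof.
move=> O0.
have := @combination_continuous (0, 0, 0); rewrite /continuous_at /=.
rewrite addr0 subr0 => /(_ _ O0).
move=> [[/= P Q]] [[[/= A B]] [A0 B0] ABP Q0] PQ.
exists (A `&` B `&` Q); split; first by apply: filterI => //; exact: filterI.
move=> u v w [[Au Bu] _] [[Av Bv] _] [_ Qw].
by apply: (PQ (u, v, w)); split => //=; exact: (ABP (u, v)).
Qed.

End GroupTopology.

Lemma metrizable_hausdorff (R : realType) (T : topologicalType) :
  metrizable R T -> hausdorff_space T.
Proof.
move=> [d [d0 ds dt dn]]; rewrite open_hausdorff => x y xy.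
have dge0 a b : 0 <= d a b.
  have := dt a b a; rewrite (d0 a a).2// (ds b a); lra.
have dxy : 0 < d x y.
  by rewrite lt_neqAle dge0 andbT; apply/eqP => /esym/d0 /eqP; rewrite (negbTE xy).
have ball_nbhs z e : 0 < e -> nbhs z [set w | d z w < e].
  by move=> e0; rewrite dn; exists e.
have h2 : 0 < d x y / 2 by rewrite divr_gt0.
exists ([set w | d x w < d x y / 2]°, [set w | d y w < d x y / 2]°) => /=.
  by rewrite !inE; split; exact: ball_nbhs.
split; [exact: open_interior|exact: open_interior|].
apply/eqP; rewrite -subset0 => z [/interior_subset/= xz /interior_subset/= yz].
have := dt x z y; rewrite (ds z y); lra.
Qed.

Record haar_rotation (R : realType) (T : topologicalZmodType) (g : T)
    (m : probability (borel T) R) : Prop := HaarRotation {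
  rot_compact : compact [set: T];
  rot_metrizable : metrizable R T;
  rot_infinite : infinite_set [set: T];
  rot_minimal : minimal_rotation g;
  rot_haar : normalized_haar m }.

Section Haar.
Context {R : realType} {T : topologicalZmodType} {g : T}.
Context {m : probability (borel T) R} (H : haar_rotation g m).
Implicit Types (A O : set T) (x t : T).

Local Notation mass := (mass m).

Lemma rot_hausdorff : hausdorff_space T.
Proof. exact: metrizable_hausdorff (rot_metrizable H). Qed.

Lemma closed1 x : closed [set x].
Proof. by apply: compact_closed; [exact: rot_hausdorff|exact: compact_set1]. Qed.

Lemma closed_compactT A : closed A -> compact A.
Proof. by move=> cA; apply: (subclosed_compact cA (rot_compact H)). Qed.

Lemma borel_shift t A : borel_set A -> borel_set [set x | A (x + t)].
Proof.
move=> mA.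
suff mf : measurable_fun [set: borel T] (fun x : borel T => (x + t : T) : borel T).
  by have := mf measurableT A mA; rewrite setTI.
apply: (@measurability _ _ (borel T) (borel T) _ _ (@open T)) => //.
move=> _ [U oU <-]; rewrite setTI; apply: open_borel; exact: open_shift.
Qed.

Lemma mass_shift t A : borel_set A -> mass [set x | A (x + t)] = mass A.
Proof.
move=> mA; rewrite /mass.
rewrite -(rot_haar H t (borel_shift t mA)); congr (fine (m _)).
apply/seteqP; split => [x [y /= Ay <-]|x Ax /=]; first by rewrite addrC.
by exists (x - t); rewrite /= ?subrK// addrC subrK.
Qed.

(** Translates of [O] by finitely many multiples of [g] cover the compact group
([compact_near_coveringP] provides the uniformity); shifting the starting point
by a large multiple of [g] turns integer times into natural ones. *)
Lemma uniform_hitting O : open O -> O !=set0 ->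
  exists K, forall x, exists2 k, (k <= K)%N & O (x + g *+ k).
Proof.
move=> oO O0.
have /compact_near_coveringP cT := rot_compact H.
pose P (K : nat) x := exists2 k : int, (`|k| <= K)%N & O (x + g *~ k).
have : \forall K \near \oo, [set: T] `<=` P K.
  apply: cT => x _.
  have [z [Oz [k _ zE]]] := rot_minimal H x O0 oO.
  exists ([set y | O (y + g *~ k)], [set K | (`|k| <= K)%N]) => /=.
    split; last by exists `|k|%N.
    apply: open_nbhs_nbhs; split; first exact: open_shift.
    by rewrite /= zE.
  by move=> [y K] /= [Oy kK]; exists k.
move=> [K _ /(_ K (leqnn K)) /= KP]; exists (K + K)%N => x.
have [k kK Ok] := KP (x + g *+ K) I.
have [j jE] : exists j : nat, (j : int) = K%:Z + k.
  by exists `|(K%:Z + k)%R|%N; lia.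
exists j; first by lia.
by rewrite pmulrn jE mulrzDr addrA -pmulrn.
Qed.

(** Finitely many translates of an open set, all of the same mass, cover the group. *)
Lemma open_mass_gt0 O : open O -> O !=set0 -> 0 < mass O.
Proof.
move=> oO O0; have [K KP] := uniform_hitting oO O0.
have h : 1 <= \sum_(i < K.+1) 1 * mass [set x | O (x + g *+ i)].
  apply: (@sum_mass_ge _ _ m K.+1 (fun i => [set x | O (x + g *+ i)]) (fun=> 1)) => //.
    by move=> i; apply: open_borel; exact: open_shift.
  move=> x; have [k kK Ok] := KP x.
  rewrite (bigD1 (Ordinal (kK : (k < K.+1)%N)))//= mul1r.
  rewrite indicE mem_set//= lerDl; apply: sumr_ge0 => i _.
  by rewrite mul1r indicE ler0n.
have {}h : 1 <= K.+1%:R * mass O.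
  apply: le_trans h _.
  rewrite (eq_bigr (fun=> mass O)); last first.
    by move=> i _; rewrite mul1r mass_shift//; exact: open_borel.
  by rewrite sumr_const card_ord mulr_natl.
rewrite lt_neqAle mass_ge0 andbT; apply/eqP => mO0.
by rewrite -mO0 mulr0 ler10 in h.
Qed.

(** All points have the same mass, and an infinite group has arbitrarily many. *)
Lemma mass_set1 x : mass [set x] = 0.
Proof.
apply/eqP; rewrite eq_le mass_ge0 andbT leNgt; apply/negP => mx.
have mxy y : mass [set y] = mass [set x].
  rewrite -(@mass_shift (y - x) [set y]); last by apply: closed_borel; exact: closed1.
  congr mass; apply/seteqP; split => z /=.
    by move=> /eqP; rewrite addrA -subr_eq0 addrAC addrK subr_eq0 => /eqP.
  by move=> ->; rewrite addrC subrK.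
have /infiniteP/pcard_leP/injfunPex[/= q _ q_inj] :=
  (rot_infinite H : infinite_set [set: borel T]).
have small n : n%:R * mass [set x] <= 1.
  have -> : n%:R * mass [set x] = \sum_(i < n) 1 * mass [set q i].
    rewrite (eq_bigr (fun=> mass [set x])); last by move=> i _; rewrite mul1r mxy.
    by rewrite sumr_const card_ord mulr_natl.
  apply: (@sum_mass_le _ _ m n (fun i => [set q i]) (fun=> 1)) => // [i|y].
    by apply: closed_borel; exact: closed1.
  have [[i iE]|ny] := pselect (exists i : 'I_n, q i = y); last first.
    rewrite big1// => i _; rewrite indicE memNset ?mulr0// => /= yE.
    by apply: ny; exists i.
  rewrite (bigD1 i)//= big1 ?addr0 ?mul1r ?indicE ?lern1 ?leq_b1// => j ji.
  rewrite indicE memNset ?mulr0//= => yE; case/eqP: ji.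
  apply/val_inj/q_inj; rewrite ?inE//.
  exact: (etrans (esym yE) (esym iE)).
have := archi_boundP (ltW (_ : 0 < (mass [set x])^-1)).
rewrite invr_gt0 => /(_ mx); rewrite -[X in X < _]mul1r ltr_pdivrMr//.
by rewrite ltNge small.
Qed.

End Haar.

(** * Uniform bounds on visit averages *)

Section Base.
Context {R : realType} {T : topologicalZmodType} {g : T}.
Context {m : probability (borel T) R} (H : haar_rotation g m).
Implicit Types (A D O : set T) (x t : T).

Local Notation mass := (mass m).

(** A decreasing base of neighbourhoods of 0 with null boundaries; its translates
serve at the other points. *)
Definition null_base (V : nat -> set T) : Prop :=
  [/\ forall n, open (V n), forall n, V n 0, forall n, V n.+1 `<=` V n,
      forall n, mass (closure (V n) `\` V n) = 0 &
      forall O, nbhs 0 O -> exists n, closure (V n) `<=` O].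

(** The level sets of [f] are disjoint, so that only countably many of them have
positive mass, whereas an interval is uncountable. *)
Lemma null_fibre_between (f : T -> R) (a b : R) :
  (forall r, open [set x | r < f x]) -> a < b ->
  exists r, a < r < b /\ mass [set x | f x = r] = 0.
Proof.
move=> fo ab; apply: contrapT => noR.
have mf : measurable_fun [set: borel T] (f : borel T -> R).
  apply: (@measurability _ _ (borel T) R setT (f : borel T -> R) (@RGenOInfty.G R)).
    exact: RGenOInfty.measurableE.
  move=> _ [U [r ->] <-]; rewrite setTI; apply: open_borel.
  by have := fo r; congr open; apply/seteqP; split => x /=; rewrite in_itv/= andbT.
have fm : (f : borel T -> R) \in mfun by rewrite inE.
have cP := pmf_gt0_countable (mfun_Sub fm : {RV m >-> R}).
have sub : [set` `]a, b[] `<=` [set r | 0 < pmf (mfun_Sub fm : {RV m >-> R}) r].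
  move=> r /=; rewrite in_itv/= => arb; rewrite lt_neqAle pmf_ge0 andbT.
  by apply/eqP => fr; apply: noR; exists r; split => //; rewrite fr.
have := countable_lebesgue_measure0 (sub_countable (subset_card_le sub) cP).
rewrite lebesgue_measure_itv/= lte_fin ab -EFinB => -[] /eqP.
by rewrite subr_eq0 gt_eqF.
Qed.

(** Balls around 0, with radii for which the sphere is null. *)
Lemma exists_null_base : exists V, null_base V.
Proof.
have [d [d0 ds dt dn]] := rot_metrizable H.
have dge0 a b : 0 <= d a b.
  have := dt a b a; rewrite (d0 a a).2// (ds b a); lra.
have gto r : open [set y | r < d 0 y].
  rewrite openE => y /= ry; rewrite /interior dn; exists (d 0 y - r) => /=.
    by rewrite subr_gt0.
  move=> z /= yz; have := dt 0 z y; rewrite (ds z y); lra.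
have lto r : open [set y | d 0 y < r].
  rewrite openE => y /= ry; rewrite /interior dn; exists (r - d 0 y) => /=.
    by rewrite subr_gt0.
  move=> z /= yz; have := dt 0 y z; lra.
have /choice[r rP] (n : nat) : exists r : R,
    n.+2%:R^-1 < r < n.+1%:R^-1 /\ mass [set y | d 0 y = r] = 0.
  by apply: null_fibre_between => //; rewrite ltf_pV2 ?posrE// ltr_nat.
have r0 n : 0 < r n.
  by have [/andP[+ _] _] := rP n; apply: le_lt_trans; rewrite invr_ge0.
have clV n : closure [set y | d 0 y < r n] `<=` [set y | d 0 y <= r n].
  rewrite closureE; apply: smallest_sub; last by move=> y /= /ltW.
  by rewrite -openC; have := gto (r n); congr open; apply/seteqP; split => y /=;
    rewrite ltNge => /negP.
exists (fun n => [set y | d 0 y < r n]); split => //.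
- by move=> n /=; rewrite (d0 0 0).2.
- move=> n y /= /lt_trans; apply.
  have [/andP[_ a] _] := rP n.+1; have [/andP[b _] _] := rP n.
  exact: lt_trans b.
- move=> n; apply/eqP; rewrite eq_le mass_ge0 andbT.
  have [_ <-] := rP n; apply: mass_mono.
  + apply: measurableD; last exact: open_borel.
    by apply: closed_borel; exact: closed_closure.
  + rewrite (_ : [set y | _] = ~` ([set y | r n < d 0 y] `|` [set y | d 0 y < r n])).
      by apply: measurableC; apply: measurableU; exact: open_borel.
    apply/seteqP; split => y /=; first by move=> ->; rewrite ltxx => -[].
    by move=> /not_orP[/negP + /negP]; rewrite -!leNgt => a b; apply/eqP; rewrite eq_le a b.
  + move=> y [/clV /= yr /negP]; rewrite -leNgt => ry.
    by apply/eqP; rewrite eq_le yr ry.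
- move=> O; rewrite dn => -[e /= e0 eO].
  have [n ne] : exists n : nat, n.+1%:R^-1 < e.
    by have [n _ /(_ n (leqnn n)) /= nP] := near_infty_natSinv_lt (PosNum e0); exists n.
  exists n => y /clV /= yr; apply: eO => /=; apply: le_lt_trans yr _.
  by have [/andP[_ a] _] := rP n; exact: lt_trans ne.
Qed.

(** The sets [D + V n] decrease to the closed set [D]. *)
Lemma thicken (V : nat -> set T) D (e : R) : null_base V -> closed D -> 0 < e ->
  exists n O, [/\ open O, mass O < mass D + e & forall x v, D x -> V n v -> O (x + v)].
Proof.
move=> [Vo V0 Vd _ Vb] cD e0.
pose O n := \bigcup_(x in D) [set y | V n (y - x)].
have oO n : open (O n) by apply: bigcup_open => x _; exact: open_shift.
have Od n : O n.+1 `<=` O n by move=> y [x Dx Vyx]; exists x => //; exact: Vd.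
have OD : \bigcap_n O n = D.
  apply/seteqP; split => [y yO|x Dx n _]; last first.
    by exists x => //=; rewrite subrr; exact: V0.
  rewrite (closure_id D).1// => U /nbhs_shift yU.
  have h : nbhs (0 : T) [set v | U (y - v)].
    have := @opp_continuous T 0; rewrite /continuous_at oppr0 => /(_ _ yU); exact: id.
  have [n nU] := Vb _ h.
  have [x Dx Vyx] := yO n I; exists x; split => //.
  have := nU _ (@subset_closure _ (V n) (y - x) Vyx).
  by rewrite /= opprB addrC subrK; exact: id.
have [n _ /(_ n (leqnn n)) /= nP] :=
  @mass_bigcap_cvg _ _ m O e e0 (fun n => open_borel (oO n)) Od.
exists n, (O n); split => //; first by rewrite -OD.
by move=> x v Dx Vv; exists x => //=; rewrite addrC addKr.
Qed.

Lemma sum_shift_le (F : nat -> R) k n : (forall i, 0 <= F i <= 1) ->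
  \sum_(i < n) F i <= k%:R + \sum_(i < n) F (i + k)%N.
Proof.
move=> F01; elim: k => [|k ih]; first by
  under [X in 0 + X]eq_bigr do rewrite addn0; rewrite add0r.
apply: (le_trans ih); rewrite -natr1 -addrA lerD2l.
have : F k + \sum_(i < n) F (i + k.+1)%N = \sum_(i < n) F (i + k)%N + F (n + k)%N.
  rewrite -[RHS](big_ord_recr n (fun i => F (i + k)%N)) big_ord_recl add0n.
  by congr (_ + _); apply: eq_bigr => i _; rewrite lift0 addSnnS.
have := F01 k; have := F01 (n + k)%N; lra.
Qed.

Lemma indic01 A x : 0 <= (\1_A x : R) <= 1.
Proof. by rewrite indicE; case: (_ \in _) => /=; rewrite ?lexx ?ler01. Qed.

Lemma indic_le A B x (y : T) : (A x -> B y) -> (\1_A x : R) <= \1_B y.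
Proof.
move=> AB; rewrite !indicE; have [Ax|nAx] := pselect (A x).
  by rewrite !mem_set//; exact: AB.
by rewrite memNset// ler0n.
Qed.

Lemma visit_averageE n A x :
  visit_average g A x n = \sum_(i < n) n%:R^-1 * \1_A (x + g *+ i) :> R.
Proof. by rewrite /visit_average mulr_sumr. Qed.

(** By minimality the orbit of [x], delayed by at most [K] steps, follows the orbit
of any other point [y] up to a small translation; hence each visit of [x] to
[D], but for [K] of them, is a visit of [y] to the thickened set [O]. Integrating
over [y] bounds the number of visits by [K + n * mass O]. *)
Lemma visit_upper_bound D (e : R) : closed D -> 0 < e ->
  exists N, forall n x, (N <= n)%N -> visit_average g D x n <= mass D + e.
Proof.
move=> cD e0; have [V bV] := exists_null_base.
have e20 : 0 < e / 2 by rewrite divr_gt0.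
have [n0 [ O [oO mO DVO]]] := thicken bV cD e20.
have [Vo V0 _ _ _] := bV.
have oW : open [set y | V n0 (- y)].
  by apply: open_comp => // y _; exact: opp_continuous.
have [K KP] := uniform_hitting H oW (ex_intro _ 0 (eq_ind_r (V n0) (V0 n0) (oppr0 T))).
have key n x : \sum_(i < n) (\1_D (x + g *+ i) : R) - K%:R <=
    \sum_(i < n) 1 * mass [set y | O (y + g *+ i)].
  have S0 : 0 <= \sum_(i < n) 1 * mass [set y | O (y + g *+ i)].
    by apply: sumr_ge0 => i _; rewrite mul1r mass_ge0.
  have [b0|/ltW b0] := leP 0 (\sum_(i < n) (\1_D (x + g *+ i) : R) - K%:R);
    last exact: le_trans S0.
  apply: (@sum_mass_ge _ _ m n (fun i => [set y | O (y + g *+ i)]) (fun=> 1)) => //.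
    by move=> i; apply: open_borel; exact: open_shift.
  move=> y; rewrite lerBlDl.
  have [k kK Vk] := KP (x - y).
  have := @sum_shift_le (fun i => \1_D (x + g *+ i)) k n (fun i => indic01 D _).
  move=> /le_trans; apply; apply: lerD; first by rewrite ler_nat.
  apply: ler_sum => i _; rewrite mul1r; apply: indic_le => /= Dx.
  have := DVO _ _ Dx Vk; congr O.
  rewrite mulrnDr; apply: (addIr (x - y + g *+ k)).
  by rewrite subrK [RHS]addrACA [y + _]addrC subrK.
exists (Num.bound (K%:R / (e / 2))).+1 => n x nN.
have n0' : 0 < n%:R :> R by rewrite ltr0n (leq_trans _ nN).
have Kn : K%:R <= e / 2 * n%:R.
  rewrite mulrC -ler_pdivrMr//; apply: ltW.
  apply: lt_le_trans (archi_boundP _) _; first by rewrite divr_ge0// ltW.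
  by rewrite ler_nat (leq_trans _ nN).
have := key n x.
have -> : \sum_(i < n) 1 * mass [set y | O (y + g *+ i)] = n%:R * mass O.
  rewrite (eq_bigr (fun=> mass O)) ?sumr_const ?card_ord ?mulr_natl// => i _.
  by rewrite mul1r (mass_shift H)//; exact: open_borel.
move=> h.
rewrite /visit_average ler_pdivrMl//.
have : n%:R * mass O <= n%:R * (mass D + e / 2) by rewrite ler_pM2l// ltW.
move: Kn h; set S := \sum_(i < n) _; set k := K%:R; set nn := n%:R.
set o := mass O; set dd := mass D.
nra.
Qed.

Lemma near_visit_le D x n : closed D ->
  \forall y \near x, forall i, (i < n)%N -> (\1_D (y + g *+ i) : R) <= \1_D (x + g *+ i).
Proof.
move=> cD; elim: n => [|n ih]; first by apply: nearW => y i; rewrite ltn0.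
have [Dx|nDx] := pselect (D (x + g *+ n)).
  apply: filterS ih => y yP i; rewrite ltnS leq_eqVlt => /orP[/eqP ->|]; last exact: yP.
  exact: indic_le.
have : \forall y \near x, ~ D (y + g *+ n).
  apply: open_nbhs_nbhs; split => //=.
  have := @open_shift T (g *+ n) _ (closed_openC cD); exact.
apply: filterS2 ih => y yP nDy i; rewrite ltnS leq_eqVlt => /orP[/eqP ->|]; last exact: yP.
exact: indic_le.
Qed.

Lemma visit_average_le n A B x (y : T) :
  (forall i, (i < n)%N -> (\1_A (x + g *+ i) : R) <= \1_B (y + g *+ i)) ->
  visit_average g A x n <= visit_average g B y n :> R.
Proof.
move=> h; rewrite !visit_averageE; apply: ler_sum => i _.
by apply: ler_wpM2l => //; exact: h.
Qed.

Lemma open_visit_lt D n (a : R) : closed D -> open [set x | visit_average g D x n < a].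
Proof.
move=> cD; rewrite openE => x /= xa; rewrite /interior.
apply: filterS (near_visit_le x n cD) => y yP /=.
exact: le_lt_trans (visit_average_le yP) xa.
Qed.

(** The average has mean [mass D] and is nowhere much larger, so that it is rarely
much smaller. This is the form in which ergodicity is used. *)
Lemma visit_average_in_measure D (d eta : R) : closed D -> 0 < d -> 0 < eta ->
  exists N, forall n, (N <= n)%N ->
    mass [set x | visit_average g D x n < mass D - d] <= eta.
Proof.
move=> cD d0 eta0; have [N NP] := visit_upper_bound cD (mulr_gt0 d0 eta0).
exists N.+1 => n nN.
have n0 : (n%:R : R) != 0 by rewrite pnatr_eq0 -lt0n (leq_trans _ nN).
pose X := [set x | visit_average g D x n < mass D - d].
pose E i := if (i < n)%N then [set x | D (x + g *+ i)] else X.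
pose a i : R := if (i < n)%N then n%:R^-1 else d.
have mE i : borel_set (E i).
  rewrite /E; case: ifP => _; first by apply: closed_borel; exact: closed_shift.
  by apply: open_borel; exact: open_visit_lt.
(* The [n] translates of [D], with weight [1 / n], together with the exceptional
   set [X], with weight [d]: where [X] holds the average leaves room for [d]. *)
have := @sum_mass_le _ _ m n.+1 E a (mass D + d * eta) mE.
rewrite big_ord_recr/=.
have -> : \sum_(i < n) a i * mass (E i) = mass D.
  rewrite (eq_bigr (fun=> n%:R^-1 * mass D)).
    by rewrite sumr_const card_ord -[LHS]mulr_natl mulrA divff// mul1r.
  by move=> i _; rewrite /E /a ltn_ord (mass_shift H)//; exact: closed_borel.
have -> : E n = X by rewrite /E ltnn.
have -> : a n = d by rewrite /a ltnn.
rewrite lerD2l (ler_pM2l d0); apply.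
  by move=> i; rewrite /a; case: ifP => _; rewrite ?invr_ge0// ltW.
move=> x; rewrite big_ord_recr/=.
have -> : E n = X by rewrite /E ltnn.
have -> : a n = d by rewrite /a ltnn.
have -> : \sum_(i < n) a i * \1_(E i) x = visit_average g D x n.
  by rewrite visit_averageE; apply: eq_bigr => i _; rewrite /a /E ltn_ord.
rewrite indicE; have [Xx|nXx] := pselect (X x).
  rewrite mem_set//= mulr1; move: Xx; rewrite /X /= => Xx.
  have := mulr_gt0 d0 eta0; lra.
by rewrite memNset//= mulr0 addr0; apply: NP; exact: ltnW.
Qed.

End Base.

(** * Visit frequencies of closed sets *)

Section Frequencies.
Context {R : realType} {T : topologicalZmodType} {g : T}.
Context {m : probability (borel T) R} (H : haar_rotation g m).
Implicit Types (A C D : set T) (x : T).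

Local Notation mass := (mass m).

Lemma accumulationP (u : R^nat) (nu : R) : accumulation_points u nu <->
  forall (e : R) N, 0 < e -> exists2 n, (N <= n)%N & `|nu - u n| < e.
Proof.
split=> [unu e N e0|h N _ U /nbhs_ballP[e /= e0 eU]].
  have [_ [[n /= Nn <-] nue]] := unu N I _ (nbhsx_ballx nu e e0).
  by exists n.
have [n Nn nue] := h e N e0; exists (u n); split; first by exists n.
exact: eU.
Qed.

Lemma visit_average_ge0 A x n : 0 <= visit_average g A x n :> R.
Proof.
by rewrite visit_averageE; apply: sumr_ge0 => i _; rewrite mulr_ge0 ?invr_ge0.
Qed.

Lemma visit_sumE A x n :
  n%:R * visit_average g A x n = \sum_(i < n) \1_A (x + g *+ i) :> R.
Proof.
rewrite /visit_average; case: n => [|n]; first by rewrite mul0r big_ord0.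
by rewrite mulrA divff ?mul1r// pnatr_eq0.
Qed.

Lemma visit_average_step A x n :
  `|visit_average g A x n.+1 - visit_average g A x n| <= n.+1%:R^-1 :> R.
Proof.
have n1 : 0 < n.+1%:R :> R by [].
have h1 := visit_sumE A x n.+1; have h0 := visit_sumE A x n.
rewrite big_ord_recr/= -h0 in h1.
have := @indic01 R _ A (x + g *+ n).
move: h1; set b := \1_A _.
set v' := visit_average _ _ _ _; set v := visit_average _ _ _ _ => h1 b01.
have v0 : 0 <= v by exact: visit_average_ge0.
have v1 : n%:R * v <= n%:R.
  rewrite h0 -[leRHS]mulr1 mulr_natl -[X in _ *+ X]card_ord -sumr_const.
  by apply: ler_sum => i _; case/andP: (@indic01 R _ A (x + g *+ i)).
have E : v' - v = n.+1%:R^-1 * (b - v).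
  apply: (mulfI (lt0r_neq0 n1)); rewrite mulrA divff ?mul1r ?lt0r_neq0//.
  by rewrite mulrBr h1 -natr1; ring.
have vle1 : v <= 1.
  have [n0|n0] := posnP n; first by rewrite /v n0 /visit_average big_ord0 mulr0.
  by move: v1; rewrite -[leRHS]mulr1 ler_pM2l// ltr0n.
rewrite E normrM ger0_norm ?invr_ge0// -[leRHS]mulr1 ler_pM2l ?invr_gt0//.
by rewrite ler_norml; apply/andP; split; lra.
Qed.

(** A discrete intermediate value theorem: the averages move from near 0 to near
[c] in steps of size at most [1 / n], and hence pass close to every value in
between. *)
Lemma oscillation_accumulation A x (c : R) :
  (forall (e : R) N, 0 < e ->
    exists2 n, (N <= n)%N & (visit_average g A x n : R) < e) ->
  (forall (e : R) N, 0 < e ->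
    exists2 n, (N <= n)%N & c - e < visit_average g A x n) ->
  forall nu : R, 0 <= nu <= c -> accumulation_points (visit_average g A x) nu.
Proof.
move=> lo hi nu /andP[nu0 nuc]; apply/accumulationP => e N e0.
pose M := maxn N (Num.bound e^-1).
have stepM n : (M <= n)%N -> n.+1%:R^-1 < e.
  move=> Mn; rewrite -[e]invrK ltf_pV2 ?posrE ?invr_gt0//.
  apply: lt_le_trans (archi_boundP _) _; first by rewrite invr_ge0 ltW.
  by rewrite ler_nat (leq_trans _ (leqW Mn))// leq_maxr.
have [n1 Mn1 n1e] := lo e M e0.
have [n2 n12 n2e] := hi e n1 e0.
have [n1big|n1small] := ltP (nu - e) (visit_average g A x n1).
  exists n1; first by rewrite (leq_trans _ Mn1)// leq_maxl.
  by rewrite ltr_norml; apply/andP; split; lra.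
(* The first time after [n1] at which the averages exceed [nu - e]. *)
pose P n := (n1 <= n)%N && (nu - e < visit_average g A x n).
have exP : exists n, P n by exists n2; rewrite /P n12/=; lra.
case: (ex_minnP exP) => -[|n] /andP[n1n ne] nmin.
  by move: n1n; rewrite leqn0 => /eqP n10; move: n1small; rewrite n10 leNgt ne.
have n1n' : (n1 <= n)%N.
  move: n1n; rewrite leq_eqVlt => /orP[/eqP n1E|//].
  by move: n1small; rewrite n1E leNgt ne.
have nsmall : visit_average g A x n <= nu - e.
  rewrite leNgt; apply/negP => nbig.
  by have := nmin n; rewrite /P n1n' nbig ltnn => /(_ isT).
exists n.+1; first by rewrite (leq_trans _ (leqW n1n'))// (leq_trans _ Mn1)// leq_maxl.
have := visit_average_step A x n; rewrite ler_norml => /andP[_ h].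
have := stepM n (leq_trans Mn1 n1n').
move: h; set q := n.+1%:R^-1 => h; rewrite ltr_norml => h'; apply/andP; split; lra.
Qed.

Lemma visit_frequencies_le C nu : closed C -> visit_frequencies g C nu ->
  0 <= nu <= mass C.
Proof.
move=> cC [x _ [/andP[nu0 _] /accumulationP nuacc]]; rewrite nu0 /=.
apply/ler_addgt0Pr => e e0; have e20 : 0 < e / 2 by rewrite divr_gt0.
have [N NP] := visit_upper_bound H cC e20.
have [n Nn] := nuacc _ N e20; have := NP n x Nn.
rewrite ltr_norml => h /andP[_ h']; lra.
Qed.

Lemma oscillation_maximal C x : closed C ->
  (forall (e : R) N, 0 < e ->
    exists2 n, (N <= n)%N & (visit_average g C x n : R) < e) ->
  (forall (e : R) N, 0 < e ->
    exists2 n, (N <= n)%N & mass C - e < visit_average g C x n) ->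
  maximal_frequencies g C m.
Proof.
move=> cC lo hi; apply/seteqP; split => nu /=; rewrite in_itv/=.
  exact: visit_frequencies_le.
move=> nuC; exists x => //; split.
  case/andP: nuC => -> /le_trans; apply.
  by apply: mass_le1; exact: closed_borel.
exact: oscillation_accumulation lo hi nu nuC.
Qed.

End Frequencies.

(** * Sets with relatively clopen traces *)

Lemma nested_closed_nonempty (T : topologicalType) (F : nat -> set T) :
  compact [set: T] -> (forall n, closed (F n)) -> (forall n, F n.+1 `<=` F n) ->
  (forall n, F n !=set0) -> exists x, forall n, F n x.
Proof.
move=> cT cF dF F0; apply: contrapT => noF.
have dF' i j : (i <= j)%N -> F j `<=` F i.
  move=> ij; rewrite -(subnK ij); elim: (j - i)%N => [//|k ih].
  by rewrite addSn; apply: subset_trans ih; exact: dF.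
move/compact_near_coveringP : cT => /(_ nat \oo (fun n x => ~ F n x) _).
case.
  move=> x _; have [n nFx] : exists n, ~ F n x.
    apply: contrapT => /forallNP h; apply: noF; exists x => n.
    by apply: contrapT; exact: h.
  exists (~` F n, [set k | (n <= k)%N]) => /=.
    split; last by exists n.
    by apply: open_nbhs_nbhs; split => //; exact: closed_openC.
  by move=> [y k] /= [nFy nk] /(dF' _ _ nk).
move=> n _ /(_ n (leqnn n)) nF; have [x Fx] := F0 n.
exact: nF Fx.
Qed.

Lemma exists_small_inverse (R : realType) N (e : R) : 0 < e ->
  exists2 k, (N <= k)%N & k.+1%:R^-1 < e.
Proof.
move=> e0; have [k _ kP] := near_infty_natSinv_lt (PosNum e0).
by exists (maxn N k); [exact: leq_maxl|apply: kP => /=; exact: leq_maxr].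
Qed.

Lemma open_forall_lt (T : topologicalType) (F : nat -> set T) n :
  (forall i, open (F i)) -> open [set x | forall i, (i < n)%N -> F i x].
Proof.
move=> oF; elim: n => [|n ih].
  by rewrite (_ : [set _ | _] = setT) ?predeqE//; exact: openT.
rewrite (_ : [set _ | _] = [set x | forall i, (i < n)%N -> F i x] `&` F n).
  exact: openI.
apply/seteqP; split => x /=; first by move=> h; split => [i /ltnW/h|]; [|exact: h].
by move=> [h Fn] i; rewrite ltnS leq_eqVlt => /orP[/eqP ->|/h].
Qed.

Section ClopenTraces.
Context {R : realType} {T : topologicalZmodType} {g : T}.
Context {m : probability (borel T) R} (H : haar_rotation g m).
Context (C : set T) (x0 : T).
Hypothesis cC : closed C.
Hypothesis C_gt0 : 0 < mass m C.
Hypothesis trace : forall n, closed (C `\` [set x | C (x + g *+ n)]).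
Hypothesis x0C : forall n, ~ C (x0 + g *+ n).

Local Notation mass := (mass m).

(** Relatively clopen in the closed set [C]. By the hypothesis [trace] this notion is
stable under prescribing whether the orbit is in [C] at given times. *)
Definition clopen_in (V : set T) := [/\ closed V, V `<=` C & closed (C `\` V)].

Lemma clopen_in_split (V : set T) n : clopen_in V ->
  clopen_in (V `&` [set x | C (x + g *+ n)]) /\
  clopen_in (V `\` [set x | C (x + g *+ n)]).
Proof.
move=> [cV VC cCV]; have cB : closed [set x | C (x + g *+ n)] by exact: closed_shift.
split; split.
- exact: closedI.
- by move=> x [/VC].
- rewrite setDIr; exact: closedU.
- have -> : V `\` [set x | C (x + g *+ n)] = V `&` (C `\` [set x | C (x + g *+ n)]).
    apply/seteqP; split => x /= [Vx]; last by case.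
    by move=> nC; split => //; split => //; exact: VC.
  exact: closedI.
- by move=> x [/VC].
- rewrite setDDr; apply: closedU => //; exact: closedI.
Qed.

(** Split [V] successively according to membership in [C] at times [0, ..., n - 1],
each time keeping a half that meets [Y] in positive mass. *)
Lemma clopen_in_refine V Y n : clopen_in V -> borel_set Y -> 0 < mass (V `&` Y) ->
  exists V', [/\ clopen_in V', V' `<=` V, 0 < mass (V' `&` Y) &
    forall x y i, V' x -> V' y -> (i < n)%N -> C (x + g *+ i) -> C (y + g *+ i)].
Proof.
move=> VC mY VY; elim: n => [|n [V' [V'C V'V V'Y V'n]]]; first by exists V; split.
have [c1 c2] := clopen_in_split n V'C.
set V1 := V' `&` _ in c1; set V2 := V' `\` _ in c2.
have [V1Y|V1Y] := ltP 0 (mass (V1 `&` Y)).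
  exists V1; split => //; first by move=> x [/V'V].
  move=> x y i [Vx Cx] [Vy Cy]; rewrite ltnS leq_eqVlt => /orP[/eqP -> //|].
  exact: V'n.
exists V2; split => //; first by move=> x [/V'V].
  apply: lt_le_trans V'Y _.
  have -> : V' `&` Y = (V1 `&` Y) `|` (V2 `&` Y).
    by rewrite -setIUl /V1 /V2 setDE -setIUr setUv setIT.
  have b1 : borel_set (V1 `&` Y).
    by apply: measurableI => //; apply: closed_borel; case: c1.
  have b2 : borel_set (V2 `&` Y).
    by apply: measurableI => //; apply: closed_borel; case: c2.
  by apply: le_trans (massU_le m b1 b2) _; rewrite -[leRHS]add0r lerD2r.
move=> x y i [Vx nCx] [Vy _]; rewrite ltnS leq_eqVlt => /orP[/eqP -> /nCx //|].
exact: V'n.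
Qed.

Lemma clopen_in_average V Y n : clopen_in V -> borel_set Y -> 0 < mass (V `&` Y) ->
  exists V', [/\ clopen_in V', V' `<=` V, 0 < mass V' &
    exists2 x, Y x & V x /\
      forall y, V' y -> visit_average g C y n = visit_average g C x n :> R].
Proof.
move=> cV mY VY; have [V' [c' V'V V'Y V'n]] := clopen_in_refine n cV mY VY.
have b' : borel_set V' by apply: closed_borel; case: c'.
have [x [V'x Yx]] := mass_gt0_nonempty V'Y.
exists V'; split => //.
  by apply: lt_le_trans V'Y _; apply: mass_mono => //; exact: measurableI.
exists x => //; split; first exact: V'V.
move=> y V'y; rewrite !visit_averageE; apply: eq_bigr => i _; congr (_ * _).
apply/eqP; rewrite eq_le; apply/andP.
by split; apply: indic_le => h; apply: V'n h.
Qed.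

(** The averages are close to [mass C] in measure, hence at some point of [V]; passing
to a relatively clopen piece makes the average constant. *)
Lemma clopen_in_high V (e : R) N : clopen_in V -> 0 < mass V -> 0 < e ->
  exists V', [/\ clopen_in V', V' `<=` V, 0 < mass V' &
    exists2 n, (N <= n)%N & forall y, V' y -> mass C - e < visit_average g C y n].
Proof.
move=> cV V0 e0; have e20 : 0 < e / 2 by rewrite divr_gt0.
have [N' N'P] := visit_average_in_measure H cC e20 (divr_gt0 V0 (ltr0n R 2)).
pose n := maxn N N'; pose X := [set x | visit_average g C x n < mass C - e / 2].
have mX : borel_set X by apply: open_borel; exact: open_visit_lt.
have mV : borel_set V by apply: closed_borel; case: cV.
have VX : 0 < mass (V `&` ~` X).
  have bX : borel_set (~` X) by exact: measurableC.
  have : mass V <= mass (V `&` ~` X) + mass X.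
    apply: le_trans (massU_le m _ mX); last exact: measurableI.
    apply: mass_mono => //; first by apply: measurableU => //; exact: measurableI.
    by move=> x Vx; have [|] := pselect (X x); [right|left].
  have := N'P n (leq_maxr _ _); rewrite -/X => h1 h2.
  have : mass V - mass V / 2 <= mass (V `&` ~` X) by lra.
  by apply: lt_le_trans; lra.
have [V' [c' V'V V'0 [x Xx [Vx V'y]]]] := clopen_in_average n cV (measurableC mX) VX.
exists V'; split => //; exists n; first exact: leq_maxl.
move=> y /V'y ->; move: Xx; rewrite /X /= => /negP; rewrite -leNgt.
apply: lt_le_trans; lra.
Qed.

Lemma count_end (L M n : nat) : (\sum_(i < n) (L <= i + M) <= n + M - L)%N.
Proof.
elim: n => [|n ih]; first by rewrite big_ord0.
by rewrite big_ord_recr/=; move: ih; case: leqP => /=; lia.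
Qed.

(** On this set the averages of [V] along the orbit of [x + g] vanish, although they
are close to [mass V] off sets of arbitrarily small mass. *)
Lemma never_return_null V : closed V -> 0 < mass V ->
  mass [set x | forall i, (0 < i)%N -> ~ V (x + g *+ i)] = 0.
Proof.
move=> cV V0; set K := [set x | _].
have KE : K = \bigcap_i [set x | ~ V (x + g *+ i.+1)].
  apply/seteqP; split => [x Kx i _|x Kx [//|i] _]; first exact: Kx.
  exact: Kx.
have mK : borel_set K.
  rewrite KE; apply: bigcap_measurable => // i _; apply: open_borel.
  exact: open_shift (closed_openC cV).
apply/eqP; rewrite eq_le mass_ge0 andbT; apply/ler_addgt0Pr => e e0; rewrite add0r.
have V20 : 0 < mass V / 2 by rewrite divr_gt0.
have [N NP] := visit_average_in_measure H cV V20 e0.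
have := NP N (leqnn N); set X := [set x | _] => Xe; apply: le_trans Xe.
have oX : open X by exact: open_visit_lt.
rewrite -(mass_shift H g (open_borel oX)); apply: mass_mono => //.
  by apply: open_borel; exact: open_shift.
move=> x Kx; rewrite /X/= /visit_average big1; first by rewrite mulr0; lra.
move=> i _; rewrite indicE memNset// -addrA -mulrS; exact: Kx.
Qed.

(** The points of [C] with no visit to [V] within [M] steps form a closed set, since
[V] is relatively open in [C] and [C] has relatively clopen traces. For this
closed set [visit_upper_bound] is available. *)
Lemma visited_before V M : clopen_in V ->
  closed (C `&` [set x | forall i, (0 < i <= M)%N -> ~ V (x + g *+ i)]).
Proof.
move=> [cV VC cCV]; have -> : C `&` [set x | forall i, (0 < i <= M)%N -> ~ V (x + g *+ i)] =
   C `&` \bigcap_(i in [set i | (0 < i <= M)%N])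
     ((C `\` [set x | C (x + g *+ i)]) `|` [set x | (C `\` V) (x + g *+ i)]).
  apply/seteqP; split => x [Cx xP]; split => //.
    move=> i iM; have nV := xP i iM.
    have [Ci|nCi] := pselect (C (x + g *+ i)); [by right|by left].
  move=> i iM Vi; have [[_ nC]|[_ nV]] := xP i iM; last exact: nV.
  exact/nC/VC.
apply: closedI => //; apply: closed_bigI => i _; apply: closedU => //.
exact: closed_shift.
Qed.

(** Every orbit meets a stretch of [L] steps outside of [C], because it comes close
to [x0]. If almost every point of [V] came back to [V] within less than [L] steps,
then so would almost every later visit, and the last visit to [V] before
such a stretch would be impossible. *)
Lemma long_excursion_gt0 V L : clopen_in V -> 0 < mass V -> (0 < L)%N ->
  0 < mass (V `&` [set x | forall i, (0 < i < L)%N -> ~ V (x + g *+ i)]).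
Proof.
move=> [cV VC _] V0 L0; set Q := V `&` _.
have mQ : borel_set Q.
  have -> : Q = V `&` \bigcap_(i in [set i | (0 < i < L)%N]) [set x | ~ V (x + g *+ i)].
    by apply/seteqP; split => x [Vx xP]; split.
  apply: measurableI; first exact: closed_borel.
  apply: bigcap_measurableType => i _; apply: open_borel.
  exact: open_shift (closed_openC cV).
rewrite lt_neqAle mass_ge0 andbT; apply/eqP => Q0.
have N0 : mass (\bigcup_v [set x | Q (x + g *+ v)]) = 0.
  by apply: mass_bigcup0 => v; [exact: borel_shift|rewrite (mass_shift H)].
have [x [Vx nx]] : exists x, V x /\ forall v, ~ Q (x + g *+ v).
  apply: contrapT => h; move: V0; rewrite lt_neqAle => /andP[/eqP + _]; apply.
  apply/eqP; rewrite eq_le mass_ge0/= -N0; apply: mass_mono; first exact: closed_borel.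
    by apply: bigcup_measurable => v _; exact: borel_shift.
  move=> x Vx; apply: contrapT => h'; apply: h; exists x; split => // v Qv.
  by apply: h'; exists v.
have oO : open [set y | forall i, (i < L)%N -> ~ C (y + g *+ i)].
  by apply: open_forall_lt => i; exact: open_shift (closed_openC cC).
have [K KP] := uniform_hitting H oO (ex_intro _ x0 (fun i _ => @x0C i)).
have [k kK Ok] := KP x.
have exV : exists v, (v <= k)%N && `[< V (x + g *+ v) >].
  by exists 0%N; rewrite mulr0n addr0; apply/asboolP.
have ubV v : (v <= k)%N && `[< V (x + g *+ v) >] -> (v <= k)%N by case/andP.
case: (ex_maxnP exV ubV) => v /andP[vk /asboolP Vv] vmax.
have nQ := nx v; apply: nQ; split => // i /andP[i0 iL] Vvi.
rewrite -addrA -mulrnDr in Vvi.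
have vk' : (v < k)%N.
  rewrite ltn_neqAle vk andbT; apply/eqP => vkE.
  by have := Ok 0%N L0; rewrite mulr0n addr0 -vkE; apply; exact: VC.
have [vik|kvi] := leqP (v + i)%N k.
  have := vmax (v + i)%N; rewrite vik.
  have -> : `[< V (x + g *+ (v + i)) >] by apply/asboolP.
  by move=> /(_ isT); lia.
apply: (Ok (v + i - k)%N); first by lia.
by rewrite -addrA -mulrnDr subnKC ?(ltnW kvi)//; exact: VC.
Qed.

(** Start an excursion of [L] steps from [V]. The points of [C] that do not return to
[V] within [M] steps form a closed set of small mass, so that the orbit visits it
rarely; all other visits to [C] during the excursion fall into its last [M] steps. *)
Lemma clopen_in_low V (e : R) N : clopen_in V -> 0 < mass V -> 0 < e ->
  exists V', [/\ clopen_in V', V' `<=` V, 0 < mass V' &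
    exists2 n, (N <= n)%N & forall y, V' y -> visit_average g C y n < e].
Proof.
move=> cV V0 e0; have e30 : 0 < e / 3 by rewrite divr_gt0.
have [cV' VC _] := cV.
pose D M := C `&` [set x | forall i, (0 < i <= M)%N -> ~ V (x + g *+ i)].
have cD M : closed (D M) by exact: visited_before.
have D0 : mass (\bigcap_M D M) = 0.
  apply/eqP; rewrite eq_le mass_ge0 andbT -(never_return_null cV' V0).
  apply: mass_mono.
  - by apply: bigcap_measurableType => M _; exact: closed_borel.
  - have -> : [set x | forall i, (0 < i)%N -> ~ V (x + g *+ i)] =
        \bigcap_(i in [set i | (0 < i)%N]) [set x | ~ V (x + g *+ i)] by [].
    apply: bigcap_measurableType => i _; apply: open_borel.
    exact: open_shift (closed_openC cV').
  - by move=> x xD i i0; have [_ /(_ i)] := xD i I; apply; rewrite i0/=.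
have dD M : D M.+1 `<=` D M.
  by move=> x [Cx xM]; split => // i /andP[i0 iM]; apply: xM; rewrite i0 leqW.
have [M _ /(_ M (leqnn M)) /=] :=
  @mass_bigcap_cvg _ _ m D _ e30 (fun M => closed_borel (cD M)) dD.
rewrite D0 add0r => DM.
have [N1 N1P] := visit_upper_bound H (cD M) e30.
pose L := (maxn (maxn N N1) (Num.bound (M%:R / (e / 3)))).+1.
have L0 : 0 < L%:R :> R by rewrite ltr0n.
have ML : M%:R < e / 3 * L%:R.
  rewrite mulrC -ltr_pdivrMr//.
  apply: lt_trans (archi_boundP _) _; first by rewrite divr_ge0// ltW.
  by rewrite ltr_nat ltnS leq_maxr.
have mQ : borel_set [set x | forall i, (0 < i < L)%N -> ~ V (x + g *+ i)].
  have -> : [set x | forall i, (0 < i < L)%N -> ~ V (x + g *+ i)] =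
      \bigcap_(i in [set i | (0 < i < L)%N]) [set x | ~ V (x + g *+ i)] by [].
  apply: bigcap_measurableType => i _; apply: open_borel.
  exact: open_shift (closed_openC cV').
have [V' [c' V'V V'0 [x Qx [Vx V'y]]]] :=
  clopen_in_average L cV mQ (long_excursion_gt0 cV V0 (ltn0Sn _)).
exists V'; split => //; exists L.
  by rewrite leqW// (leq_trans (leq_maxl _ N1))// leq_maxl.
move=> y /V'y ->.
have := N1P L x; rewrite (leq_trans _ (leqW (leq_maxl _ _))) ?leq_maxr// => /(_ isT) h.
have hS : \sum_(i < L) \1_C (x + g *+ i) <=
    \sum_(i < L) \1_(D M) (x + g *+ i) + M%:R :> R.
  apply: le_trans (_ : \sum_(i < L) (\1_(D M) (x + g *+ i) + (L <= i + M)%:R) <= _).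
    apply: ler_sum => i _.
    have [Ci|nCi] := pselect (C (x + g *+ i)); last first.
      by rewrite !indicE memNset//= addr_ge0.
    have [Di|nDi] := pselect (D M (x + g *+ i)).
      by rewrite !indicE !mem_set//= lerDl.
    have -> : (L <= i + M)%N.
      rewrite leqNgt; apply/negP => iML; apply: nDi; split => // j /andP[j0 jM].
      by rewrite -addrA -mulrnDr; apply: Qx; lia.
    by rewrite !indicE mem_set//= lerDr.
  rewrite big_split/= lerD2l -natr_sum ler_nat.
  by apply: leq_trans (count_end L M L) _; rewrite addKn.
rewrite -!visit_sumE in hS.
have : L%:R * (visit_average g C x L) < L%:R * e.
  have : L%:R * visit_average g (D M) x L <= L%:R * (mass (D M) + e / 3).
    by rewrite ler_pM2l.
  have : L%:R * (mass (D M) + e / 3) < L%:R * (e / 3 + e / 3).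
    by rewrite ltr_pM2l// ltrD2r.
  move: hS ML; set a := L%:R * visit_average _ _ _ _.
  set b := L%:R * visit_average _ _ _ _.
  set l := L%:R; set k := M%:R; nra.
by rewrite ltr_pM2l.
Qed.

(** A point in the intersection of nested relatively clopen sets, on which the
averages are near 0 and near [mass C] at later and later times. *)
Lemma clopen_trace_maximal : maximal_frequencies g C m.
Proof.
pose X := {V : set T | clopen_in V /\ 0 < mass V}.
pose good (k : nat) (V V' : X) := [/\ sval V' `<=` sval V,
  exists2 n, (k <= n)%N & forall y, sval V' y -> visit_average g C y n < k.+1%:R^-1 :> R &
  exists2 n, (k <= n)%N &
    forall y, sval V' y -> mass C - k.+1%:R^-1 < visit_average g C y n].
have step (kV : nat * X) : exists V', good kV.1 kV.2 V'.
  case: kV => k [V [cV V0]] /=.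
  have k0 : 0 < k.+1%:R^-1 :> R by rewrite invr_gt0.
  have [V1 [c1 V1V V10 [n kn nP]]] := clopen_in_low k cV V0 k0.
  have [V2 [c2 V2V V20 [n' kn' nP']]] := clopen_in_high k c1 V10 k0.
  exists (exist _ V2 (conj c2 V20)); split => /=; first exact: subset_trans V1V.
    by exists n => // y /V2V /nP.
  by exists n'.
have [f fP] := choice step.
have cC0 : clopen_in C /\ 0 < mass C.
  by split => //; split => //; rewrite setDv; exact: closed0.
pose W := fix W k : X := if k is k'.+1 then f (k', W k') else exist _ C cC0.
have WP k : good k (W k) (W k.+1) by exact: fP (k, W k).
have [x xW] : exists x, forall k, sval (W k) x.
  apply: nested_closed_nonempty (rot_compact H) _ _ _ => k.
  - by case: (svalP (W k)) => -[].
  - by case: (WP k).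
  - by case: (svalP (W k)) => _ /mass_gt0_nonempty.
apply: (oscillation_maximal H cC (x := x)) => e N /(exists_small_inverse N)[k Nk ke];
  have [_ [n kn nP] [n' kn' nP']] := WP k.
  by exists n; [exact: leq_trans kn|exact: lt_trans (nP _ (xW k.+1)) ke].
exists n'; first exact: leq_trans kn'.
by apply: lt_trans (nP' _ (xW k.+1)); rewrite ltrD2l ltrN2.
Qed.

End ClopenTraces.

(** * Extensions with fibres of at most two points *)

Section TwoPointFibres.
Context {T : topologicalZmodType} {g : T} {p : nat}.
Context (W : 'I_p -> set T) (pi : symbolic_space p -> T).
Hypothesis T_hausdorff : hausdorff_space T.
Hypothesis W_cover : \bigcup_i W i = setT.
Hypothesis W_disjoint : forall i j, i != j -> (W i)° `&` (W j)° = set0.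
Hypothesis W_regular : forall i, regclosed (W i).
Hypothesis pi_factor : almost_1to1_factor_map g W pi.

Local Notation Sigma := (almost_automorphic_subshift g W).

Lemma cover_closed i : closed (W i).
Proof. by rewrite -(W_regular i); exact: closed_closure. Qed.

Lemma interior_cover_inj i j t : (W i)° t -> W j t -> i = j.
Proof.
move=> it; rewrite -(W_regular j) => jt; apply/eqP/negPn/negP => ij.
have [z [jz iz]] := jt _ (open_nbhs_nbhs (conj (@open_interior _ (W i)) it)).
by have := W_disjoint ij; rewrite predeqE => /(_ z) [+ _]; apply.
Qed.

Lemma cover_boundaryP t :
  cover_boundary W t <-> exists i j, [/\ i != j, W i t & W j t].
Proof.
split=> [[i _ [+ nit]]|[i [j [ij Wi Wj]]]].
  rewrite -(closure_id (W i)).1; last exact: cover_closed.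
  move=> Wi; exists i; apply: contrapT => nj.
  pose F := \bigcup_(j in [set j | j != i]) W j.
  have cF : closed F.
    by apply: closed_bigcup => [|j _]; [exact: finite_finset|exact: cover_closed].
  apply: nit; rewrite /interior.
  have : nbhs t (~` F).
    apply: open_nbhs_nbhs; split; first exact: closed_openC.
    by move=> [j /= ji Wj]; apply: nj; exists j; rewrite eq_sym.
  apply: filterS => z nFz.
  have [j _ Wj] : (\bigcup_i W i) z by rewrite W_cover.
  by have [<-//|ji] := eqVneq j i; exfalso; apply: nFz; exists j.
exists i => //; split; first exact: subset_closure.
by move=> /interior_cover_inj /(_ Wj) /eqP; rewrite (negbTE ij).
Qed.

Lemma closed_cover_boundary : closed (cover_boundary W).
Proof.
apply: closed_bigcup => [|i _]; first exact: finite_finset.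
rewrite /boundary setDE; apply: closedI; first exact: closed_closure.
exact/open_closedC/open_interior.
Qed.

Lemma closed_symbol (n : int) a : closed [set x : symbolic_space p | x n = a].
Proof.
have -> : [set x : symbolic_space p | x n = a] =
    (fun x : symbolic_space p => x n) @^-1` [set a] by [].
apply: closed_comp; last exact: discrete_closed.
move=> x _; exact: (@proj_continuous int (fun=> discrete_topology 'I_p) n).
Qed.

Lemma closed_image_subshift (A : set (symbolic_space p)) :
  closed A -> closed (pi @` (Sigma `&` A)).
Proof.
move=> cA; have [pic _ _ _ _] := pi_factor.
apply: compact_closed => //; apply: continuous_compact.
  by apply: continuous_subspaceW pic => x [].
apply: (@subclosed_compact _ _ [set x : symbolic_space p | forall i, setT (x i)]) => //.
  by apply: closedI => //; exact: closed_closure.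
have fin : finite_set [set: discrete_topology 'I_p] := @finite_finset 'I_p setT.
exact: (@tychonoff int (fun=> discrete_topology 'I_p) (fun=> setT)
  (fun=> finite_compact fin)).
Qed.

(** Over a point of the interior of [W i] every element of the fibre carries the symbol
[i]; the general case follows since [W i] is the closure of its interior and
images of closed subsets of the subshift are closed. *)
Lemma cover_symbol (n : int) i t : W i (t + g *~ n) ->
  exists2 x, fibre g W pi t x & x n = i.
Proof.
have [_ pis _ _ piW] := pi_factor.
rewrite -(W_regular i) => it.
suff : (pi @` (Sigma `&` [set x | x n = i])) t by move=> [x [Sx xn] <-]; exists x.
rewrite (closure_id (pi @` (Sigma `&` _))).1;
  last exact/closed_image_subshift/closed_symbol.
have : closure [set s | (W i)° (s + g *~ n)] t by rewrite closure_shift.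
apply: closure_subset => s /= Wis.
have [x Sx pix] : (pi @` Sigma) s by rewrite pis.
exists x => //; split => //=; apply/esym; apply: interior_cover_inj Wis _.
by rewrite -pix; exact: piW.
Qed.

Lemma cover_boundary_fibre (n : int) t : cover_boundary W (t + g *~ n) <->
  exists x y, [/\ fibre g W pi t x, fibre g W pi t y & x n <> y n].
Proof.
have [_ _ _ _ piW] := pi_factor.
split=> [/cover_boundaryP[i [j [ij /cover_symbol[x tx xi] /cover_symbol[y ty yj]]]]|].
  by exists x, y; split => //; rewrite xi yj; apply/eqP.
move=> [x [y [[Sx tx] [Sy ty] xy]]]; apply/cover_boundaryP.
exists (x n), (y n); split; first exact/eqP.
  by rewrite -tx; exact: piW.
by rewrite -ty; exact: piW.
Qed.

Lemma fibre2P t x y z : (fibre g W pi t #<= `I_2)%card ->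
  fibre g W pi t x -> fibre g W pi t y -> fibre g W pi t z ->
  x <> y -> z = x \/ z = y.
Proof.
move=> /pcard_leP/injfunPex[/= f fI finj] tx ty tz xy.
have f2 u : fibre g W pi t u -> f u = 0%N \/ f u = 1%N.
  by move=> /fI /=; case: (f u) => [|[|]]; [left|right|].
have inj u v : fibre g W pi t u -> fibre g W pi t v -> f u = f v -> u = v.
  by move=> tu tv; apply: finj; rewrite inE.
have fxy : f x <> f y by move=> /(inj _ _ tx ty).
have [fx|fx] := f2 _ tx; have [fy|fy] := f2 _ ty; have [fz|fz] := f2 _ tz;
  rewrite ?fx ?fy // in fxy.
all: first [by left; apply: inj => //; rewrite fz fx
           |by right; apply: inj => //; rewrite fz fy].
Qed.

(** When two distinct points exhaust the fibre over [t], disagreement at time 0 and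
agreement at time [n] can be read off from a pair of fibre elements showing
symbols [a, c] and [b, c] with [a <> b]. For fixed symbols this is
a closed condition on [t], and there are finitely many choices. *)
Lemma closed_boundary_trace n :
  (forall t, (fibre g W pi t #<= `I_2)%card) ->
  closed (cover_boundary W `\` [set t | cover_boundary W (t + g *+ n)]).
Proof.
move=> fib2.
pose P (a c : 'I_p) := pi @` (Sigma `&` ([set x | x 0 = a] `&` [set x | x n%:Z = c])).
have cP a c : closed (P a c).
  by apply: closed_image_subshift; apply: closedI; exact: closed_symbol.
have -> : cover_boundary W `\` [set t | cover_boundary W (t + g *+ n)] =
  \bigcup_(abc in [set abc : 'I_p * 'I_p * 'I_p | abc.1.1 != abc.1.2])
     (P abc.1.1 abc.2 `&` P abc.1.2 abc.2).
  apply/seteqP; split => t /=.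
    move=> [Bt nBt]; have : cover_boundary W (t + g *~ 0) by rewrite mulr0z addr0.
    move=> /cover_boundary_fibre[x [y [tx ty xy]]].
    have xyn : x n%:Z = y n%:Z.
      apply: contrapT => xyn; apply: nBt; rewrite pmulrn.
      by apply/cover_boundary_fibre; exists x, y.
    exists (x 0, y 0, x n%:Z) => /=; first exact/eqP.
    by split; [exists x|exists y]; case: tx; case: ty.
  move=> [[[a b] c] /= /eqP ab [[x [Sx [x0 xn]] tx] [y [Sy [y0 yn]] ty]]].
  have Fx : fibre g W pi t x by [].
  have Fy : fibre g W pi t y by [].
  split.
    rewrite -[t]addr0 -(mulr0z g); apply/cover_boundary_fibre.
    by exists x, y; split => //; rewrite x0 y0.
  rewrite pmulrn => /cover_boundary_fibre[u [v [Fu Fv uv]]].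
  have xy : x <> y by move=> xyE; apply: ab; rewrite -x0 -y0 xyE.
  have sym z : fibre g W pi t z -> z n%:Z = c.
    by move=> Fz; have [->|->] := fibre2P (fib2 t) Fx Fy Fz xy.
  by apply: uv; rewrite !sym.
apply: closed_bigcup => [|abc _]; first exact: finite_finset.
exact: closedI.
Qed.

End TwoPointFibres.

Lemma two_point_fibres_maximal (R : realType) (T : topologicalZmodType) (g : T)
    (m : probability (borel T) R) (p : nat) (W : 'I_p -> set T)
    (pi : symbolic_space p -> T) : haar_rotation g m ->
  separating_cover g W -> almost_1to1_factor_map g W pi ->
  (forall t, (fibre g W pi t #<= `I_2)%card) ->
  maximal_frequencies g (cover_boundary W) m.
Proof.
move=> H [Wc Wd Wr _] fac fib2.
have hT := rot_hausdorff H.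
have cC : closed (cover_boundary W) by exact: closed_cover_boundary.
have [C0|] := ltP 0 (mass m (cover_boundary W)); last first.
  (* When the boundary is null, the averages tend to 0 along every orbit. *)
  move=> C0; apply: (oscillation_maximal H cC (x := 0)) => e N e0.
    have [N1 N1P] := visit_upper_bound H cC (divr_gt0 e0 (ltr0n R 2)).
    exists (maxn N N1); first exact: leq_maxl.
    apply: le_lt_trans (N1P _ _ (leq_maxr _ _)) _; lra.
  exists N => //; apply: lt_le_trans (visit_average_ge0 _ _ _); lra.
have [_ _ _ [t [x tx]] _] := fac.
apply: (clopen_trace_maximal H (x0 := t) cC C0) => n.
  exact: closed_boundary_trace fac n fib2.
rewrite pmulrn => /(cover_boundary_fibre hT Wc Wd Wr fac) => -[y [z []]].
by rewrite tx => -> ->.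
Qed.

(** * Islands: small closed sets with null shores *)

(** Dependent choice in which each term may depend on the list of all earlier ones. *)
Lemma history_choice (X : eqType) (P : seq X -> X -> Prop) :
  (forall s, exists x, P s x) -> exists f : nat -> X, forall k, P (mkseq f k) (f k).
Proof.
move=> /choice[F FP].
pose h := fix h k := if k is k'.+1 then rcons (h k') (F (h k')) else [::].
exists (F \o h) => k; suff <- : h k = mkseq (F \o h) k by exact: FP.
elim: k => [//|k ih]; have -> : mkseq (F \o h) k.+1 = rcons (mkseq (F \o h) k) (F (h k)).
  by rewrite /mkseq -[in LHS]addn1 iotaD map_cat cats1.
by rewrite -ih.
Qed.

Lemma mem_mkseq_lt (X : eqType) (f : nat -> X) l k : (l < k)%N -> f l \in mkseq f k.
Proof. by move=> lk; apply: map_f; rewrite mem_iota. Qed.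

Lemma near_all_seq (X : eqType) (I : Type) (F : set_system I)
    (Q : X -> I -> Prop) (s : seq X) :
  Filter F -> (forall x, x \in s -> \forall n \near F, Q x n) ->
  \forall n \near F, forall x, x \in s -> Q x n.
Proof.
move=> FF; elim: s => [|a s ih] h; first by apply: nearW => n x; rewrite in_nil.
have h1 : \forall n \near F, Q a n by apply: h; rewrite inE eqxx.
have h2 : \forall n \near F, forall x, x \in s -> Q x n.
  by apply: ih => x xs; apply: h; rewrite inE xs orbT.
by apply: filterS2 h1 h2 => n Qa Qs x; rewrite inE => /orP[/eqP -> //|]; exact: Qs.
Qed.

Section Islands.
Context {R : realType} {T : topologicalZmodType} {g : T}.
Context {m : probability (borel T) R} (H : haar_rotation g m).
Context (V : nat -> set T).
Hypothesis bV : null_base (m := m) V.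

Local Notation mass := (mass m).

Lemma base_open n : open (V n). Proof. by case: bV. Qed.
Lemma base0 n : V n 0. Proof. by case: bV. Qed.

Lemma base_le i j : (i <= j)%N -> V j `<=` V i.
Proof.
move=> ij; rewrite -(subnK ij); elim: (j - i)%N => [//|k ih].
by rewrite addSn; apply: subset_trans ih; case: bV.
Qed.

Lemma near_base O : nbhs 0 O -> \forall n \near \oo, closure (V n) `<=` O.
Proof.
move=> O0; have [_ _ _ _ Vb] := bV; have [N NO] := Vb O O0.
by exists N => // n /= Nn; apply: subset_trans NO; apply: closure_subset; exact: base_le.
Qed.

Definition island (y : T) n := [set x | closure (V n) (x - y)].
Definition island_core (y : T) n := [set x | V n (x - y)].
Definition shore y n := island y n `\` island_core y n.
(** The Minkowski combination [island + island - island]: it contains the translate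
of the island by any difference of two of its points. *)
Definition island_spread (y : T) n :=
  [set x | exists u v w,
    [/\ closure (V n) u, closure (V n) v, closure (V n) w & x = y + (u + v - w)]].

Lemma closed_island y n : closed (island y n).
Proof. by apply: closed_shift; exact: closed_closure. Qed.

Lemma open_island_core y n : open (island_core y n).
Proof. by apply: open_shift; exact: base_open. Qed.

Lemma island_core_sub y n : island_core y n `<=` island y n.
Proof. by move=> x Vx; exact: (@subset_closure _ (V n)). Qed.

Lemma closure_island_core y n : closure (island_core y n) = island y n.
Proof. exact: closure_shift. Qed.

Lemma closed_shore y n : closed (shore y n).
Proof.
rewrite /shore setDE; apply: closedI; first exact: closed_island.
exact/open_closedC/open_island_core.
Qed.

Lemma mass_shore y n : mass (shore y n) = 0.
Proof.
have -> : shore y n = [set x | (closure (V n) `\` V n) (x - y)] by [].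
rewrite (mass_shift H); first by case: bV.
apply: measurableD; last by apply: open_borel; exact: base_open.
by apply: closed_borel; exact: closed_closure.
Qed.

Lemma mass_island y n : mass (island y n) = mass (closure (V n)).
Proof. by rewrite (mass_shift H)//; apply: closed_borel; exact: closed_closure. Qed.

Lemma mass_island_core y n : mass (island_core y n) = mass (island y n).
Proof.
apply/eqP; rewrite eq_le; apply/andP; split.
  apply: mass_mono (@island_core_sub y n).
    by apply: open_borel; exact: open_island_core.
  by apply: closed_borel; exact: closed_island.
rewrite -[leRHS]addr0 -(mass_shore y n).
have mc : borel_set (island_core y n) by apply: open_borel; exact: open_island_core.
have ms : borel_set (shore y n) by apply: closed_borel; exact: closed_shore.
apply: le_trans (massU_le m mc ms); apply: mass_mono.
- by apply: closed_borel; exact: closed_island.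
- exact: measurableU.
- by move=> x Ix; have [|] := pselect (island_core y n x); [left|right].
Qed.

Lemma mass_island_gt0 y n : 0 < mass (island y n).
Proof.
rewrite -mass_island_core; apply: (open_mass_gt0 H); first exact: open_island_core.
by exists y; rewrite /island_core/= subrr; exact: base0.
Qed.

Lemma near_island y O : open O -> O y -> \forall n \near \oo, island y n `<=` O.
Proof.
move=> oO Oy; have /nbhs_shift/near_base : nbhs y O by exact: open_nbhs_nbhs.
by apply: filterS => n nO x /nO /=; rewrite addrC subrK.
Qed.

Lemma near_combination O : nbhs (0 : T) O -> \forall n \near \oo,
  forall u v w, closure (V n) u -> closure (V n) v -> closure (V n) w -> O (u + v - w).
Proof.
move=> /nbhs0_combination[U [U0 UO]]; apply: filterS (near_base U0) => n nU u v w.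
by move=> /nU Uu /nU Uv /nU; exact: UO.
Qed.

Lemma near_island_spread y O : open O -> O y ->
  \forall n \near \oo, island_spread y n `<=` O.
Proof.
move=> oO Oy; have /nbhs_shift/near_combination : nbhs y O by exact: open_nbhs_nbhs.
by apply: filterS => n nO _ [u [v [w [nu nv nw ->]]]]; exact: nO.
Qed.

Lemma closure_base0 n : closure (V n) 0.
Proof. exact/subset_closure/base0. Qed.

Lemma near_difference t : t != 0 -> \forall n \near \oo,
  forall u v, closure (V n) u -> closure (V n) v -> u - v != t.
Proof.
move=> t0; have /near_combination : nbhs (0 : T) (~` [set t]).
  apply: open_nbhs_nbhs; split; first by apply: closed_openC; exact: (closed1 H).
  by move=> /= /esym /eqP; rewrite (negbTE t0).
apply: filterS => n nt u v nu nv; apply/eqP => uvt.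
by apply: (nt 0 u v (closure_base0 n) nu nv); rewrite add0r.
Qed.

Lemma near_mass_base (e : R) : 0 < e -> \forall n \near \oo, mass (closure (V n)) < e.
Proof.
move=> e0.
have cap : \bigcap_n closure (V n) = [set 0].
  apply/seteqP; split => [x xV|_ -> n _]; last exact: closure_base0.
  apply: contrapT => /eqP x0.
  have [n _ /(_ n (leqnn n)) /= nx] := near_difference x0.
  by have := nx x 0 (xV n I) (closure_base0 n); rewrite subr0 eqxx.
have := @mass_bigcap_cvg _ _ m (fun n => closure (V n)) e e0.
rewrite cap (mass_set1 H) add0r; apply => n.
  by apply: closed_borel; exact: closed_closure.
by apply: closure_subset; exact: base_le.
Qed.

(** Nonempty open sets have positive mass, and stay nonempty when a closed null set
is removed. *)
Lemma avoid_null (I : eqType) (s : seq I) (B : I -> set T) O : open O -> O !=set0 ->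
  (forall i, i \in s -> closed (B i) /\ mass (B i) = 0) ->
  exists O', [/\ open O', O' !=set0, O' `<=` O &
    forall i x, i \in s -> O' x -> ~ B i x].
Proof.
move=> oO O0; elim: s => [|a s ih] h; first by exists O; split.
have [| O' [oO' O'0 O'O O'B]] := ih.
  by move=> i is_; apply: h; rewrite inE is_ orbT.
have [cB B0] := h a (mem_head _ _).
have oD : open (O' `\` B a) by rewrite setDE; apply: openI => //; exact: closed_openC.
exists (O' `\` B a); split => //; last 2 first.
- by move=> x [/O'O].
- by move=> i x; rewrite inE => /orP[/eqP -> []//|is_ [ O'x _]]; exact: O'B.
have bO' := open_borel oO'; have bB := closed_borel cB; have bD := open_borel oD.
apply: (@mass_gt0_nonempty _ _ m).
have : mass O' <= mass (O' `\` B a) + mass (B a).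
  apply: le_trans (massU_le m bD bB); apply: mass_mono => //; first exact: measurableU.
  by move=> x O'x; have [|] := pselect (B a x); [right|left].
by rewrite B0 addr0; apply: lt_le_trans; exact: (open_mass_gt0 H).
Qed.

(** Otherwise the orbit of 0 is finite and misses some nonempty open set. *)
Lemma natmul_neq0 d : (0 < d)%N -> g *+ d != 0.
Proof.
move=> d0; apply/eqP => gd0.
have [| O [oO O0 _ OB]] :=
    @avoid_null nat (iota 0 d) (fun i => [set g *+ i]) setT openT (ex_intro _ 0 I).
  by move=> i _; split; [exact: (closed1 H)|exact: (mass_set1 H)].
have [K /(_ 0) [k _]] := uniform_hitting H oO O0.
rewrite add0r => Ok; apply: (OB (k %% d)%N _ _ Ok); first by rewrite mem_iota ltn_mod.
by rewrite /= {1}(divn_eq k d) mulrnDr mulnC mulrnA gd0 mul0rn add0r.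
Qed.

(** Small open sets around points of [C] such that every neighbourhood of a point
of [C] contains one of them. They are enumerated by pairs [(i, j)], standing for
the neighbourhood [V j] of [g *+ i], whenever that meets [C]. *)
Lemma targets C : C !=set0 -> exists (c : nat -> T) (G : nat -> set T),
  [/\ forall k, open (G k), forall k, C (c k) /\ G k (c k),
      forall k u, G k u -> V k (u - c k) &
      forall t U, C t -> nbhs t U -> exists k, G k `<=` U].
Proof.
move=> [c0 Cc0].
pose B (ij : nat * nat) := [set u | V ij.2 (u - g *+ ij.1)].
pose b k := odflt (0, 0)%N (unpickle k).
have /choice[c cP] k : exists c, C c /\ (B (b k) `&` C !=set0 -> B (b k) c).
  have [[u [Bu Cu]]|nB] := pselect (B (b k) `&` C !=set0); first by exists u.
  by exists c0.
exists c, (fun k => [set u | V k (u - c k)] `&`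
  [set u | (B (b k) `&` C !=set0) -> B (b k) u]); split.
- move=> k; apply: openI; first by apply: open_shift; exact: base_open.
  have [Bk|nB] := pselect (B (b k) `&` C !=set0).
    have -> : [set u | B (b k) `&` C !=set0 -> B (b k) u] = B (b k).
      by apply/seteqP; split => u /=; [exact|].
    by apply: open_shift; exact: base_open.
  by have -> : [set u | B (b k) `&` C !=set0 -> B (b k) u] = setT;
    [apply/seteqP; split => u // _ /= /nB|exact: openT].
- move=> k; have [Ck Bk] := cP k; split => //; split => //=.
  by rewrite subrr; exact: base0.
- by move=> k u [].
move=> t U Ct /nbhs_shift/near_combination[j _ /(_ j (leqnn j)) /= jU].
have oW : open [set u | V j (t - u)].
  have := @open_comp _ _ (fun u : T => - u) _ _ (@open_shift _ t _ (base_open j)).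
  rewrite (_ : _ @^-1` _ = [set u | V j (t - u)]); last first.
    by apply/seteqP; split => u /=; rewrite addrC.
  by apply => u _; exact: opp_continuous.
have W0 : [set u | V j (t - u)] !=set0 by exists t; rewrite /= subrr; exact: base0.
have [K /(_ 0) [i _]] := uniform_hitting H oW W0; rewrite add0r /= => Vji.
exists (pickle (i, j)) => u [_ /=]; rewrite /b pickleK /= => Bu.
have {}Bu : B (i, j) u by apply: Bu; exists t.
have := jU 0 (u - g *+ i) (t - g *+ i) (closure_base0 j)
  (@subset_closure _ (V j) _ Bu) (@subset_closure _ (V j) _ Vji).
by rewrite add0r opprB subrKA addrC subrK; exact.
Qed.

End Islands.

(** * A chain of islands clustering at a nowhere dense set *)

Section IslandChain.
Context {R : realType} {T : topologicalZmodType} {g : T}.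
Context {m : probability (borel T) R} (H : haar_rotation g m).
Context (V : nat -> set T).
Hypothesis bV : null_base (m := m) V.
Context (C : set T).
Hypothesis cC : closed C.
Hypothesis C0 : C !=set0.
Hypothesis C_meagre : forall O, open O -> O !=set0 -> O `\` C !=set0.

Local Notation mass := (mass m).
Local Notation island := (island V).
Local Notation shore := (shore V).
Local Notation island_spread := (island_spread V).

(** Islands [island (y k) (n k)] and points [z k] of the open sea such that the islands
cluster exactly at [C], and so do the points [z k] ([chain_target], [chain_near],
[chain_sea]). The clauses [chain_return] and [chain_shore] space out the visits of
an orbit to the shores; [chain_apart] and [chain_mass] keep a nonzero translation
from carrying islands to islands. *)
Record island_chain (y : nat -> T) (n : nat -> nat) (z : nat -> T) : Prop :=
  IslandChain {
  chain_radius : forall k, (k <= n k)%N;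
  chain_target : forall t U, C t -> nbhs t U ->
    exists k, island (y k) (n k) `<=` U /\ U (z k);
  chain_near : forall k, exists2 c, C c & forall u, island (y k) (n k) u -> V k (u - c);
  chain_sea : forall k, ~ C (z k) /\ forall l, ~ island (y l) (n l) (z k);
  chain_apart : forall k l u, (l < k)%N ->
    island_spread (y l) (n l) u -> ~ island (y k) (n k) u;
  chain_return : forall k u d, (0 < d <= k)%N ->
    island (y k) (n k) u -> ~ island (y k) (n k) (u + g *+ d);
  chain_shore : forall k l u d, (l < k)%N -> (d <= k)%N -> island (y k) (n k) u ->
    ~ shore (y l) (n l) (u + g *+ d) /\ ~ shore (y l) (n l) (u - g *+ d);
  chain_mass : forall k l, (l < k)%N ->
    mass (island (y k) (n k)) <= mass (island (y l) (n l)) * 2^-1 ^+ (k + 2) }.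

Let X := (T * nat * T)%type.
Let isl (x : X) := island x.1.1 x.1.2.
Let spread (x : X) := island_spread x.1.1 x.1.2.
Let shr (x : X) := shore x.1.1 x.1.2.

(** Safety keeps room for later islands near [C]: the sets that these have to avoid stay
away from [C]. *)
Definition safe (x : X) := (forall u, spread x u -> ~ C u) /\ ~ C x.2.

Lemma island_sub_spread y n : island y n `<=` island_spread y n.
Proof.
move=> u yu; exists (u - y), 0, 0; split; try exact: (closure_base0 bV).
  exact: yu.
by rewrite addr0 subr0 addrC subrK.
Qed.

Lemma closed_spread y n : closed (island_spread y n).
Proof.
have cV : compact (closure (V n)).
  by apply: (closed_compactT H); exact: closed_closure.
pose K : set (T * T * T) := (closure (V n) `*` closure (V n)) `*` closure (V n).
have -> : island_spread y n = (fun z : T * T * T => y + (z.1.1 + z.1.2 - z.2)) @` K.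
  apply/seteqP; split => u.
    by move=> [a [b [c [Va Vb Vc ->]]]]; exists (a, b, c).
  by move=> [[[a b] c] [[Va Vb] Vc] <-]; exists a, b, c.
apply: compact_closed; first exact: (rot_hausdorff H).
apply: continuous_compact; last by apply: compact_setX => //; exact: compact_setX.
apply: continuous_subspaceT => z.
apply: (@continuous_comp _ _ _
  (fun z : T * T * T => z.1.1 + z.1.2 - z.2) (fun x => y + x)).
  exact: combination_continuous.
by have := @shift_continuous T y; under eq_fun do rewrite addrC; exact.
Qed.

Section Step.
Context (c : nat -> T) (G : nat -> set T).
Hypothesis oG : forall k, open (G k).
Hypothesis cG : forall k, C (c k) /\ G k (c k).

(** What the [k]-th island has to satisfy with respect to the list [s] of the earlier
ones. A triple [(y, n, z)] stands for the island [island y n] and the sea point [z]. *)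
Definition admissible_island (s : seq X) (x : X) := let k := size s in
  (forall x', x' \in s -> safe x') ->
  [/\ safe x /\ (k <= x.1.2)%N,
      isl x `<=` G k /\ G k x.2,
      ~ isl x x.2,
      forall x', x' \in s -> [/\ ~ isl x x'.2, ~ isl x' x.2,
        forall u, spread x' u -> ~ isl x u &
        mass (isl x) <= mass (isl x') * 2^-1 ^+ (k + 2)] &
      forall u d, isl x u -> (d <= k)%N -> ((0 < d)%N -> ~ isl x (u + g *+ d)) /\
        forall x', x' \in s -> ~ shr x' (u + g *+ d) /\ ~ shr x' (u - g *+ d)].

(** The centre [y] is chosen in a target, off [C] and everything built so far, and off
the null set of points meeting an earlier shore within [k] steps; then every
requirement holds once the island is small enough. *)
Lemma exists_admissible_island s : exists x, admissible_island s x.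
Proof.
have [ss|] := pselect (forall x', x' \in s -> safe x'); last first.
  by move=> ns; exists (0, 0%N, 0); rewrite /admissible_island => h; case: (ns h).
set k := size s; have [Ck Gk] := cG k.
have /(_ s ss)[G1 [oG1 G1c G1G G1s]] :
    forall s' : seq X, (forall x', x' \in s' -> safe x') ->
    exists G1, [/\ open G1, G1 (c k), G1 `<=` G k &
      forall x' u, x' \in s' -> G1 u -> ~ spread x' u /\ u != x'.2].
  elim=> [|a s' ih] ss'; first by exists (G k); split.
  have [|G1 [oG1 G1c G1G G1s]] := ih.
    by move=> x xs; apply: ss'; rewrite inE xs orbT.
  have [sa1 sa2] := ss' a (mem_head _ _).
  exists ((G1 `\` spread a) `\` [set a.2]); split.
  - rewrite !setDE; apply: openI; first apply: openI => //.
      by apply: closed_openC; exact: closed_spread.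
    by apply: closed_openC; exact: (closed1 H).
  - by split; [split => // /sa1|move=> /= ckE; apply: sa2; rewrite -ckE].
  - by move=> u [[/G1G]].
  - move=> x u; rewrite inE => /orP[/eqP ->|xs] [[G1u nau] nua]; last exact: G1s.
    by split => //; apply/eqP.
have oO1 : open (G1 `\` C) by rewrite setDE; apply: openI => //; exact: closed_openC.
have O10 : G1 `\` C !=set0 by apply: C_meagre => //; exists (c k).
have [z [G1z nCz]] := O10.
have [|O2 [oO2 O20 O21 O2z]] :=
    @avoid_null _ _ _ _ H _ [:: z] (fun z => [set z]) _ oO1 O10.
  by move=> i _; split; [exact: (closed1 H)|exact: (mass_set1 H)].
have [|O3 [oO3 O30 O32 O3s]] :=
    @avoid_null _ _ _ _ H _ [seq (x', d) | x' <- s, d <- iota 0 k.+1]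
    (fun xd : X * nat => [set u | shr xd.1 (u + g *+ xd.2)]) _ oO2 O20.
  move=> [x' d] _; split; first by apply: closed_shift; exact: (closed_shore bV).
  rewrite (mass_shift H) ?(mass_shore H bV)//.
  by apply: closed_borel; exact: (closed_shore bV).
have [|O4 [oO4 [y O4y] O43 O4s]] :=
    @avoid_null _ _ _ _ H _ [seq (x', d) | x' <- s, d <- iota 0 k.+1]
    (fun xd : X * nat => [set u | shr xd.1 (u - g *+ xd.2)]) _ oO3 O30.
  move=> [x' d] _; split; first by apply: closed_shift; exact: (closed_shore bV).
  rewrite (mass_shift H) ?(mass_shore H bV)//.
  by apply: closed_borel; exact: (closed_shore bV).
have [G1y nCy] := O21 _ (O32 _ (O43 _ O4y)).
have n1 := near_island bV oO4 O4y.
have n2 := near_island_spread bV (closed_openC cC) nCy.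
have n3 := nbhs_infty_ge k.
have n4 : \forall n \near \oo, forall d, d \in iota 1 k ->
    forall u v, closure (V n) u -> closure (V n) v -> u - v != g *+ d.
  apply: near_all_seq => d; rewrite mem_iota => /andP[d0 _].
  exact: (near_difference H bV (natmul_neq0 H d0)).
have n5 : \forall n \near \oo, forall x', x' \in s ->
    mass (closure (V n)) < mass (isl x') * 2^-1 ^+ (k + 2).
  apply: near_all_seq => x' _; apply: (near_mass_base H bV).
  by rewrite mulr_gt0 ?exprn_gt0 ?invr_gt0//; exact: (mass_island_gt0 H bV).
have [n [[[[N1 N2] N3] N4] N5]] :=
  filter_ex (filterI (filterI (filterI (filterI n1 n2) n3) n4) n5).
have big u : island y n u -> [/\ G1 u, ~ C u & u <> z].
  move=> /N1 O4u; have O2u := O32 _ (O43 _ O4u); have [G1u nCu] := O21 _ O2u.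
  by split => //; apply: (O2z z u) => //; rewrite inE eqxx.
exists (y, n, z); rewrite /admissible_island -/k => _; split.
- by split.
- split; last exact: G1G.
  by move=> u /big[/G1G].
- by move=> /big[_ _ /=].
- move=> x' x's; split.
  + by move=> /big[G1u _ _]; have [_ /eqP] := G1s _ _ x's G1u.
  + move=> /(@island_sub_spread x'.1.1 x'.1.2).
    by have [nz _] := G1s _ _ x's G1z; exact: nz.
  + by move=> u xu /big[G1u _ _]; have [nu _] := G1s _ _ x's G1u; exact: nu.
  + by rewrite /isl/= (mass_island H V); apply: ltW; exact: N5.
- move=> u d yu dk; split.
    move=> d0; rewrite /isl/= => ydu.
    have dI : d \in iota 1 k by rewrite mem_iota d0 add1n ltnS.
    have := N4 d dI _ _ ydu yu.
    by rewrite subr_eq addrA [_ *+ _ + u]addrC eqxx.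
  move=> x' x's; have m' : (x', d) \in [seq (x', d) | x' <- s, d <- iota 0 k.+1].
    by apply/allpairsP; exists (x', d); split => //; rewrite mem_iota.
  split; first exact: (O3s _ _ m' (O43 _ (N1 _ yu))).
  exact: (O4s _ _ m' (N1 _ yu)).
Qed.

End Step.

Lemma exists_island_chain : exists y n z, island_chain y n z.
Proof.
have [c [G [oG cG GV Gd]]] := targets H bV C0.
have [f fP] := history_choice (exists_admissible_island oG cG).
have ext k : [/\ safe (f k) /\ (k <= (f k).1.2)%N,
      isl (f k) `<=` G k /\ G k (f k).2,
      ~ isl (f k) (f k).2,
      forall l, (l < k)%N -> [/\ ~ isl (f k) (f l).2, ~ isl (f l) (f k).2,
        forall u, spread (f l) u -> ~ isl (f k) u &
        mass (isl (f k)) <= mass (isl (f l)) * 2^-1 ^+ (k + 2)] &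
      forall u d, isl (f k) u -> (d <= k)%N ->
        ((0 < d)%N -> ~ isl (f k) (u + g *+ d)) /\
        forall l, (l < k)%N -> ~ shr (f l) (u + g *+ d) /\ ~ shr (f l) (u - g *+ d)].
  elim/ltn_ind: k => k ih; have := fP k; rewrite /admissible_island size_mkseq => h.
  have [|h1 h2 h3 h4 h5] := h.
    by move=> _ /mapP[l + ->]; rewrite mem_iota add0n => /ih[[]].
  split => //; first by move=> l lk; apply: h4; exact: mem_mkseq_lt.
  move=> u d fu dk; have [h51 h52] := h5 u d fu dk; split => // l lk.
  by apply: h52; exact: mem_mkseq_lt.
exists (fun k => (f k).1.1), (fun k => (f k).1.2), (fun k => (f k).2); split.
- by move=> k; case: (ext k) => -[].
- move=> t U Ct tU; have [k kU] := Gd t U Ct tU; exists k.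
  have [_ [fG Gf] _ _ _] := ext k; split; last exact: kU.
  exact: subset_trans kU.
- move=> k; exists (c k); first by case: (cG k).
  by move=> u ku; apply: GV; case: (ext k) => _ [+ _] _ _ _; apply.
- move=> k; have [[[_ nC] _] _ nk hk _] := ext k; split => // l.
  have [lk|kl|->//] := ltngtP l k; first by case: (hk l lk).
  by have [_ _ _ /(_ k kl)[]] := ext l.
- by move=> k l u lk lu; have [_ _ _ /(_ l lk)[_ _ + _] _] := ext k; apply.
- move=> k u d /andP[d0 dk] ku; have [_ _ _ _ /(_ u d ku dk)[+ _]] := ext k; exact.
- by move=> k l u d lk dk ku; have [_ _ _ _ /(_ u d ku dk)[_ /(_ l lk)]] := ext k.
- by move=> k l lk; have [_ _ _ /(_ l lk)[]] := ext k.
Qed.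

End IslandChain.

(** * Every nowhere dense set is almost the boundary of a separating cover *)

(** A division bound: hits more than [K] apart are at most one in each [K.+1] steps. *)
Lemma sparse_count (b : nat -> bool) K n :
  (forall i j, (i < j)%N -> b i -> b j -> (K < j - i)%N) ->
  (K.+1 * (\sum_(i < n) b i) <= n + K)%N.
Proof.
move=> sb; elim/ltn_ind: n => -[_|n ih]; first by rewrite big_ord0 muln0.
rewrite big_ord_recr/=; have [bn|nbn] := boolP (b n); last first.
  by rewrite addn0; apply: leq_trans (ih n (ltnSn n)) _; rewrite leq_add2r.
(* A hit at [n] excludes hits at the [K] times before it. *)
have -> : (\sum_(i < n) b i = \sum_(i < n - K) b i)%N.
  have zero d : (d <= K)%N -> (d <= n)%N -> (\sum_(i < n) b i = \sum_(i < n - d) b i)%N.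
    elim: d => [|d ihd] dK dn; first by rewrite subn0.
    rewrite ihd ?(ltnW dK) ?(ltnW dn)//.
    have -> : (n - d = (n - d.+1).+1)%N by lia.
    rewrite big_ord_recr/=.
    have [bd|_] := boolP (b (n - d.+1)%N); last by rewrite addn0.
    by have := sb (n - d.+1)%N n _ bd bn; rewrite subKn//; lia.
  have [nK|/ltnW Kn] := leqP n K; last exact: zero.
  by rewrite (zero n)// subnn; have -> : (n - K = 0)%N by lia.
have [nK|Kn] := leqP n K.
  have -> : (n - K = 0)%N by lia.
  by rewrite big_ord0 muln1; lia.
rewrite mulnDr muln1; apply: leq_trans (leq_add (ih (n - K)%N _) (leqnn _)) _; lia.
Qed.

Lemma sum_half_powers (R : realType) N :
  \sum_(i < N) 2^-1 ^+ (i + 2) <= 2^-1 :> R.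
Proof.
have -> : \sum_(i < N) 2^-1 ^+ (i + 2) = 2^-1 - 2^-1 ^+ N.+1 :> R.
  elim: N => [|N ih]; first by rewrite big_ord0 expr1 subrr.
  rewrite big_ord_recr/= ih addn2 [_ ^+ N.+2]exprS; set q := _ ^+ N.+1; lra.
by rewrite gerBl exprn_ge0// invr_ge0.
Qed.

Section CoverOfChain.
Context {R : realType} {T : topologicalZmodType} {g : T}.
Context {m : probability (borel T) R} (H : haar_rotation g m).
Context (V : nat -> set T).
Hypothesis bV : null_base (m := m) V.
Context (C : set T).
Hypothesis cC : closed C.
Context (y : nat -> T) (n : nat -> nat) (z : nat -> T).
Hypothesis chain : island_chain (g := g) (m := m) V C y n z.

Local Notation mass := (mass m).
Let I k := island V (y k) (n k).
Let O k := island_core V (y k) (n k).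
Let D := \bigcup_k shore V (y k) (n k).

Definition land := closure (\bigcup_k O k).
(** Two sets are enough to separate points: by density of the orbits it suffices that
every nonzero translation takes some point of an island into the sea. *)
Definition land_cover (i : 'I_2) : set T := if i == 0 then closure (~` land) else land.

Lemma island_land k : I k `<=` land.
Proof.
rewrite /I -closure_island_core; apply: closure_subset => u Ou; by exists k.
Qed.

(** Away from [C] only finitely many islands come close to a given point. *)
Lemma land_sub : land `<=` C `|` \bigcup_k I k.
Proof.
move=> u uL; apply: contrapT => /not_orP[nCu nIu].
have /nbhs_shift/(near_combination bV)[k0 _ /(_ k0 (leqnn k0)) /= k0P] : nbhs u (~` C).
  by apply: open_nbhs_nbhs; split => //; exact: closed_openC.
have oS : open [set v | forall k, (k < k0)%N -> ~ I k v].
  apply: open_forall_lt => k; apply: closed_openC; exact: closed_island.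
have oV : open [set v | V k0 (v - u)] by apply: open_shift; exact: (base_open bV).
have [] := uL ([set v | forall k, (k < k0)%N -> ~ I k v] `&` [set v | V k0 (v - u)]).
  apply: open_nbhs_nbhs; split; first exact: openI.
  split; first by move=> k _ Iku; apply: nIu; exists k.
  by rewrite /= subrr; exact: (base0 bV).
move=> v [[k _ Okv] [small uv]].
have [kk0|k0k] := ltnP k k0; first exact: (small k kk0 (island_core_sub Okv)).
have [c Cc Vc] := chain_near chain k.
have vc := base_le bV k0k (Vc v (island_core_sub Okv)).
have := k0P 0 (v - u) (v - c) (closure_base0 bV k0)
  (@subset_closure _ (V k0) _ uv) (@subset_closure _ (V k0) _ vc).
by rewrite add0r opprB [v - u + _]addrC subrKA addrC subrK => /(_ Cc).
Qed.

Lemma near_sea t U : C t -> nbhs t U -> ~ (U `<=` land).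
Proof.
move=> Ct tU UL; have [k [_ Uz]] := chain_target chain Ct tU.
have [nCz nIz] := chain_sea chain k.
by have [//|[l _ /nIz]] := land_sub (UL _ Uz).
Qed.

Lemma C_sub_land : C `<=` land.
Proof.
move=> t Ct U tU; have [k [IU _]] := chain_target chain Ct tU.
exists (y k); split; last first.
  by apply: IU; rewrite /island/= subrr; exact: (closure_base0 bV).
by exists k => //; rewrite /O /island_core/= subrr; exact: (base0 bV).
Qed.

Lemma interior_land : land° `<=` \bigcup_k I k.
Proof.
move=> t tL; have [Ct|//] := land_sub (interior_subset tL).
by exfalso; apply: (near_sea Ct tL).
Qed.

Lemma boundary_land : C `<=` boundary land.
Proof.
move=> t Ct; split.
  by rewrite -(closure_id land).1; [exact: C_sub_land|exact: closed_closure].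
by move=> tL; exact: (near_sea Ct tL).
Qed.

Lemma land_interior_sub : land `\` land° `<=` C `|` D.
Proof.
move=> t [tL ntL]; have [Ct|[k _ Ikt]] := land_sub tL; [by left|right].
exists k => //; split => // Ot; apply: ntL; rewrite /interior.
apply: (filterS (P := O k)); last first.
  by apply: open_nbhs_nbhs; split => //; exact: (open_island_core bV).
by apply: subset_trans (@island_land k); exact: island_core_sub.
Qed.

Lemma cover_boundary_land :
  C `<=` cover_boundary land_cover /\ cover_boundary land_cover `<=` C `|` D.
Proof.
split; first by move=> t Ct; exists (ord_max : 'I_2) => //; exact: boundary_land.
move=> t [i _]; rewrite /land_cover; case: eqP => _ [].
  rewrite -(closure_id (closure _)).1; last exact: closed_closure.
  move=> ntL nt; apply: land_interior_sub; split.
    apply: contrapT => nLt; apply: nt; rewrite /interior.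
    apply: (filterS (P := ~` land)).
      by move=> w nw; exact: (@subset_closure _ (~` land)).
    by apply: open_nbhs_nbhs; split => //; apply: closed_openC; exact: closed_closure.
  by move=> tL; have [w [nLw Lw]] := ntL _ tL.
rewrite -(closure_id land).1; last exact: closed_closure.
by move=> tL ntL; apply: land_interior_sub.
Qed.

(** By [chain_mass] each island outweighs all later ones together. *)
Lemma tail_mass k : mass (\bigcup_l I (k.+1 + l)%N) < mass (I k).
Proof.
have Ik0 : 0 < mass (I k) by exact: (mass_island_gt0 H bV).
apply: (@le_lt_trans _ _ (mass (I k) * 2^-1)); last first.
  by rewrite ltr_pdivrMr// ltr_pMr// ltr1n.
apply: mass_bigcup_le => [l|N]; first by apply: closed_borel; exact: closed_island.
have : \sum_(i < N) mass (I (k.+1 + i)%N) <= \sum_(i < N) mass (I k) * 2^-1 ^+ (i + 2).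
  apply: ler_sum => i _.
  apply: le_trans (chain_mass chain (_ : (k < k.+1 + i)%N)) _; first lia.
  rewrite ler_pM2l//.
  apply: ler_wiXn2l; [by rewrite invr_ge0|by rewrite invf_le1// ler1n|lia].
move=> /le_trans; apply; rewrite -mulr_sumr ler_pM2l//.
exact: sum_half_powers.
Qed.

(** Suppose that [t] translates the islands into the land. By induction on [k], [t] is
a difference of two points of the [k]-th island, and so [t = 0]. Indeed the
translated [k]-th island is too heavy to be covered by later islands only, and
it cannot meet an earlier one, since by induction that one would meet the [k]-th
island when moved by a difference of two of its points. *)
Lemma land_rigid t : (forall k u, O k u -> land (u + t)) -> t = 0.
Proof.
move=> tL.
have difference k : exists u v,
    [/\ closure (V (n k)) u, closure (V (n k)) v & t = u - v].
  elim/ltn_ind: k => k ih.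
  have sub u : O k u -> (\bigcup_l I l) (u + t).
    move=> Ou; apply: interior_land; rewrite /interior.
    apply: (filterS (P := [set w | O k (w - t)])).
      by move=> w /= /tL; rewrite subrK.
    apply: open_nbhs_nbhs; split; last by rewrite /= addrK.
    by apply: open_shift; exact: (open_island_core bV).
  have [u [Ou [l lk Ilu]]] : exists u, O k u /\ exists2 l, (l <= k)%N & I l (u + t).
    apply: contrapT => nu.
    have mO : borel_set (O k) by apply: open_borel; exact: (open_island_core bV).
    have mI : borel_set (\bigcup_l I (k.+1 + l)%N).
      by apply: bigcup_measurable => l _; apply: closed_borel; exact: closed_island.
    have : mass (O k) <= mass [set u | (\bigcup_l I (k.+1 + l)%N) (u + t)].
      apply: mass_mono => //; first exact: borel_shift.
      move=> u Ou; have [l _ Il] := sub u Ou; have [lk|kl] := leqP l k.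
        by exfalso; apply: nu; exists u; split => //; exists l.
      by exists (l - k.+1)%N => //; rewrite subnKC.
    rewrite (mass_shift H t mI) /O (mass_island_core H bV); apply/negP; rewrite -ltNge.
    exact: tail_mass.
  have Iu : I k u by exact: island_core_sub.
  move: lk; rewrite leq_eqVlt => /orP[/eqP lk|lk].
    exists (u + t - y k), (u - y k); split; [by rewrite -lk|exact: Iu|].
    by rewrite opprB addrA subrK addrC addKr.
  have [a [b [na nb tE]]] := ih l lk.
  exfalso; apply: (chain_apart chain lk _ Iu).
  exists (u + t - y l), b, a; split => //.
  rewrite -addrA -[b - a]opprB -tE.
  by rewrite [y l + _]addrC addrAC subrK addrK.
apply: contrapT => /eqP t0; have [N _ NP] := near_difference H bV t0.
have [u [v [nu nv tE]]] := difference N.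
by have := NP _ (chain_radius chain N) u v nu nv; rewrite tE eqxx.
Qed.

(** If [t <> t'] were not separated, then by density of the orbit of [t] the translation
by [t' - t] would map islands into the land, against [land_rigid]. *)
Lemma land_separating : separating_cover g land_cover.
Proof.
have oS : open (~` land) by apply: closed_openC; exact: closed_closure.
have W0 : land_cover 0 = closure (~` land) by [].
have W1 : land_cover ord_max = land by [].
have disj : (closure (~` land))° `&` land° = set0.
  rewrite -subset0 => t [/interior_subset tS tL].
  by have [u [nLu Lu]] := tS _ tL.
split.
- apply/seteqP; split => // t _; have [Lt|nLt] := pselect (land t).
    by exists ord_max.
  by exists 0 => //; rewrite W0; exact: (@subset_closure _ (~` land)).
- move=> i j ij; rewrite /land_cover.
  have [i0|i0] := eqVneq i 0; have [j0|j0] := eqVneq j 0 => //.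
  + by rewrite i0 j0 eqxx in ij.
  + by rewrite setIC.
  + exfalso; case/eqP: ij; apply/val_inj => /=.
    by move: i j i0 j0 => [[|[|i]] hi] [[|[|j]] hj].
- move=> i; rewrite /land_cover; case: eqP => _.
    exact: closure_open_regclosed.
  apply: closure_open_regclosed; apply: bigcup_open => k _.
  exact: (open_island_core bV).
move=> t t' tt'; apply: contrapT => nsep.
have : t' - t = 0.
  apply: land_rigid => k u Ou; apply: contrapT => nL.
  have oU : open (O k `&` [set v | ~ land (v + (t' - t))]).
    apply: openI; first exact: (open_island_core bV).
    exact: (@open_shift _ (t' - t) (~` land)).

  have [v [[Ov nLv] [j _ jE]]] := rot_minimal H t (ex_intro _ u (conj Ou nL)) oU.
  apply: nsep; exists ord_max, 0, j; split => //.
    rewrite W1 /interior; apply: (filterS (P := O k)).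
      by apply: subset_trans (@island_land k); exact: island_core_sub.
    apply: open_nbhs_nbhs; split; first exact: (open_island_core bV).
    by rewrite /= jE.
  rewrite W0 /interior; apply: (filterS (P := ~` land)).
    by move=> w nw; exact: (@subset_closure _ (~` land)).
  apply: open_nbhs_nbhs; split => //=.
  by have := nLv; rewrite /= -jE addrC addrA subrK.
by move=> /eqP; rewrite subr_eq0 eq_sym (negbTE tt').
Qed.

(** The visits of an orbit to the shores from the [K]-th on are more than [K] steps apart,
and the finitely many other shores form a closed null set. *)
Lemma shores_rare t (e : R) : 0 < e ->
  exists N, forall k, (N <= k)%N -> visit_average g D t k < e.
Proof.
move=> e0; have e40 : 0 < e / 4 by rewrite divr_gt0.
pose K := Num.bound (e / 4)^-1.
have Ke : K.+1%:R^-1 < e / 4.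
  rewrite -[ltRHS]invrK ltf_pV2 ?posrE ?invr_gt0//.
  apply: lt_le_trans (archi_boundP _) _; first by rewrite invr_ge0 ltW.
  by rewrite ler_nat.
pose D0 := \bigcup_(k in [set k | (k < K)%N]) shore V (y k) (n k).
pose D1 := \bigcup_(k in [set k | (K <= k)%N]) shore V (y k) (n k).
have cD0 : closed D0.
  apply: closed_bigcup; first exact: finite_II.
  by move=> k _; exact: (closed_shore bV).
have mD0 : mass D0 = 0.
  apply/eqP; rewrite eq_le mass_ge0 andbT.
  rewrite -(@mass_bigcup0 _ _ m (fun k => shore V (y k) (n k))); last 2 first.
  - by move=> k; apply: closed_borel; exact: (closed_shore bV).
  - by move=> k; exact: (mass_shore H bV).
  apply: mass_mono; first exact: closed_borel.
    by apply: bigcup_measurable => k _; apply: closed_borel; exact: (closed_shore bV).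
  by move=> u [k _ ku]; exists k.
have [N NP] := visit_upper_bound H cD0 e40.
have gap i j : (i < j)%N -> D1 (t + g *+ i) -> D1 (t + g *+ j) -> (K < j - i)%N.
  move=> ij [k Kk ki] [l Kl lj]; rewrite ltnNge; apply/negP => jiK.
  have ijE : t + g *+ j = t + g *+ i + g *+ (j - i).
    by rewrite -addrA -mulrnDr subnKC// ltnW.
  have [kl|lk|klE] := ltngtP k l.
  - have [_ Ii] : True /\ I l (t + g *+ j) by split => //; case: lj.
    have [_ ] := chain_shore chain kl (leq_trans jiK Kl) Ii.
    by rewrite ijE addrK.
  - have Ii : I k (t + g *+ i) by case: ki.
    have [+ _] := chain_shore chain lk (leq_trans jiK Kk) Ii.
    by rewrite -ijE.
  - have Ii : I k (t + g *+ i) by case: ki.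
    have dk : (0 < j - i <= k)%N by rewrite subn_gt0 ij (leq_trans jiK Kk).
    have := chain_return chain dk Ii; rewrite -ijE; apply.
    by rewrite /I klE; case: lj.
exists (maxn N K.+1) => k Nk.
have k0 : 0 < k%:R :> R by rewrite ltr0n (leq_trans _ Nk)// leq_max orbT.
have h0 := NP k t (leq_trans (leq_maxl _ _) Nk).
have h1 : \sum_(i < k) \1_D1 (t + g *+ i) * K.+1%:R <= k%:R + K%:R :> R.
  rewrite -mulr_suml.
  have -> : \sum_(i < k) \1_D1 (t + g *+ i) =
      (\sum_(i < k) ((t + g *+ i)%R \in D1))%:R :> R.
    by rewrite natr_sum; apply: eq_bigr => i _; rewrite indicE.
  rewrite mulrC -natrM -natrD ler_nat.
  apply: (@sparse_count (fun i => t + g *+ i \in D1)) => i j ij.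
  by rewrite !inE; exact: gap.
have h : visit_average g D t k <= visit_average g D0 t k + visit_average g D1 t k :> R.
  rewrite !visit_averageE -big_split/=; apply: ler_sum => i _; rewrite -mulrDr.
  apply: ler_wpM2l; first by rewrite invr_ge0.
  have [[l _ Dl]|nD] := pselect (D (t + g *+ i)); last first.
    by rewrite [leLHS]indicE memNset// addr_ge0.
  have [lK|Kl] := ltnP l K.
    rewrite [X in _ <= X + _]indicE (@mem_set _ D0); last by exists l.
    rewrite indicE (_ : (_ \in D)); last by rewrite inE; exists l.
    by rewrite lerDl; case/andP: (@indic01 R _ D1 (t + g *+ i)).
  rewrite [X in _ <= _ + X]indicE (@mem_set _ D1); last by exists l.
  rewrite indicE (_ : (_ \in D)); last by rewrite inE; exists l.
  by rewrite lerDr; case/andP: (@indic01 R _ D0 (t + g *+ i)).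
apply: (le_lt_trans h).
have h1' : visit_average g D1 t k <= 2 * K.+1%:R^-1 :> R.
  have K0 : 0 < K.+1%:R :> R by [].
  rewrite ler_pdivlMr// -(ler_pM2l k0) mulrA visit_sumE mulr_suml.
  apply: (le_trans h1); rewrite mulr_natr mulr2n lerD2l ler_nat.
  by rewrite (leq_trans _ Nk)// leq_max leqnSn orbT.
rewrite mD0 add0r in h0; move: Ke h1'; set q := _^-1 => Ke h1'; lra.
Qed.

End CoverOfChain.

Section Transfer.
Context {R : realType} {T : topologicalZmodType} {g : T}.
Context {m : probability (borel T) R} (H : haar_rotation g m).
Local Notation mass := (mass m).

Lemma accumulation_perturb (u v : R^nat) (nu : R) :
  (forall e : R, 0 < e -> exists N, forall n, (N <= n)%N -> `|u n - v n| < e) ->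
  accumulation_points u nu -> accumulation_points v nu.
Proof.
move=> uv /accumulationP nuu; apply/accumulationP => e N e0.
have e20 : 0 < e / 2 by rewrite divr_gt0.
have [N1 N1P] := uv _ e20; have [n Nn nun] := nuu _ (maxn N N1) e20.
exists n; first exact: leq_trans (leq_maxl _ _) Nn.
rewrite -(subrK (u n) nu) -addrA (splitr e); apply: le_lt_trans (ler_normD _ _) _.
by apply: ltrD => //; apply: N1P; exact: leq_trans (leq_maxr _ _) Nn.
Qed.

Lemma visit_frequencies_perturb (A B D : set T) :
  A `<=` B -> B `<=` A `|` D ->
  (forall t (e : R), 0 < e ->
    exists N, forall n, (N <= n)%N -> visit_average g D t n < e) ->
  visit_frequencies g B = visit_frequencies g A :> set R.
Proof.
move=> AB BAD D0.
have close t n :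
    0 <= (visit_average g B t n : R) - visit_average g A t n <= visit_average g D t n.
  rewrite !visit_averageE -sumrB; apply/andP; split.
    apply: sumr_ge0 => i _; rewrite subr_ge0 ler_wpM2l ?invr_ge0//.
    by apply: indic_le; exact: AB.
  apply: ler_sum => i _; rewrite -mulrBr ler_wpM2l ?invr_ge0// lerBlDr.
  have [Bi|nBi] := pselect (B (t + g *+ i)); last first.
    by rewrite [leLHS]indicE memNset// addr_ge0.
  have [Ai|Di] := BAD _ Bi.
    by rewrite !indicE (mem_set Bi) (mem_set Ai) lerDr.
  by rewrite !indicE (mem_set Bi) (mem_set Di) lerDl.
have acc t nu : accumulation_points (visit_average g B t : R^nat) nu <->
    accumulation_points (visit_average g A t) nu.
  split; apply: accumulation_perturb => e e0; have [N NP] := D0 t e e0;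
    exists N => n /NP; have /andP[c1 c2] := close t n.
    by rewrite ger0_norm//; exact: le_lt_trans.
  by rewrite distrC ger0_norm//; exact: le_lt_trans.
apply/seteqP; split => nu [t _ [nu01 nut]]; exists t => //; split => //.
  exact/acc.
exact/acc.
Qed.

(** The boundary of the cover by land and sea is [C] up to the shores, which are null
and invisible to visit averages along every orbit. *)
Lemma exists_cover_with_boundary (C : set T) : closed C -> C !=set0 ->
  (forall O, open O -> O !=set0 -> O `\` C !=set0) ->
  exists W : 'I_2 -> set T, [/\ separating_cover g W,
    m (cover_boundary W) = m C &
    visit_frequencies g (cover_boundary W) = visit_frequencies g C :> set R].
Proof.
move=> cC C0 C_meagre.
have [V bV] := exists_null_base H.
have [y [n [z chain]]] := exists_island_chain H bV cC C0 C_meagre.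
have [CB BCD] := cover_boundary_land bV cC chain.
have mS k : borel_set (shore V (y k) (n k)).
  by apply: closed_borel; exact: (closed_shore bV).
exists (land_cover V y n); split.
- exact: (land_separating H bV cC chain).
- have mB : borel_set (cover_boundary (land_cover V y n)).
    by apply: closed_borel; exact: closed_cover_boundary.
  have mC := closed_borel cC.
  have mD : borel_set (\bigcup_k shore V (y k) (n k)).
    by apply: bigcup_measurable => k _; exact: mS.
  have D0 : mass (\bigcup_k shore V (y k) (n k)) = 0.
    by apply: mass_bigcup0 => // k; exact: (mass_shore H bV).
  rewrite !massE//; congr EFin; apply/eqP; rewrite eq_le.
  apply/andP; split; last exact: mass_mono.
  rewrite -[leRHS]addr0 -D0; apply: le_trans (massU_le m mC mD).
  by apply: mass_mono => //; exact: measurableU.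
- apply: visit_frequencies_perturb CB BCD _ => t e e0.
  exact: (shores_rare H bV chain t e0).
Qed.

End Transfer.

(** * A nowhere dense set with all frequencies *)

Lemma closed_seq_union (X : eqType) (T : topologicalType) (F : X -> set T) (s : seq X) :
  (forall x, closed (F x)) -> closed [set u | exists2 x, x \in s & F x u].
Proof.
move=> cF; elim: s => [|a s ih].
  by rewrite (_ : [set _ | _] = set0); [exact: closed0|apply/seteqP; split => u // -[]].
rewrite (_ : [set _ | _] = F a `|` [set u | exists2 x, x \in s & F x u]).
  exact: closedU.
apply/seteqP; split => u /=.
  by move=> [x]; rewrite inE => /orP[/eqP -> |xs Fx]; [left|right; exists x].
move=> [Fa|[x xs Fx]]; first by exists a; rewrite ?mem_head.
by exists x => //; rewrite inE xs orbT.
Qed.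

Section OscillatingOrbit.
Context {R : realType} {T : topologicalZmodType} {g : T}.
Context {m : probability (borel T) R} (H : haar_rotation g m).
Context (V : nat -> set T).
Hypothesis bV : null_base (m := m) V.
Local Notation mass := (mass m).

Let X := (nat * nat * nat)%type.
(** A hole [(a, L, n)] is a neighbourhood of the stretch of the orbit of 0 that starts
at time [a] and has length [L]; its width is given by [V n]. *)
Definition hole (x : X) :=
  \bigcup_(i in `I_x.1.2) island_core V (g *+ (x.1.1 + i)) x.2.
Definition hole_closure (x : X) :=
  \bigcup_(i in `I_x.1.2) island V (g *+ (x.1.1 + i)) x.2.
Definition holes_closure (s : seq X) := [set u | exists2 x, x \in s & hole_closure x u].

Lemma closed_hole x : closed (hole_closure x).
Proof. by apply: closed_bigcup => [|i _]; [exact: finite_II|exact: closed_island]. Qed.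

Lemma mass_hole_le x : mass (hole_closure x) <= x.1.2%:R * mass (closure (V x.2)).
Proof.
have -> : x.1.2%:R * mass (closure (V x.2)) =
    \sum_(i < x.1.2) mass (island V (g *+ (x.1.1 + i)) x.2).
  rewrite (eq_bigr (fun=> mass (closure (V x.2)))).
    by rewrite sumr_const card_ord mulr_natl.
  by move=> i _; exact: (mass_island H).
rewrite /hole_closure; elim: x.1.2 => [|L ih].
  by rewrite II0 bigcup_set0 mass0 big_ord0.
rewrite big_ord_recr/=.
have c1 : borel_set (\bigcup_(i in `I_L) island V (g *+ (x.1.1 + i)) x.2).
  apply: closed_borel; apply: closed_bigcup => [|i _]; first exact: finite_II.
  exact: closed_island.
have c2 : borel_set (island V (g *+ (x.1.1 + L)) x.2).
  by apply: closed_borel; exact: closed_island.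
have -> : \bigcup_(i in `I_L.+1) island V (g *+ (x.1.1 + i)) x.2 =
    \bigcup_(i in `I_L) island V (g *+ (x.1.1 + i)) x.2 `|`
    island V (g *+ (x.1.1 + L)) x.2.
  by rewrite IIS bigcup_setU bigcup_set1.
by apply: le_trans (massU_le m c1 c2) _; rewrite lerD2r.
Qed.

(** The [k]-th hole opens at a time by which the visits of the orbit of 0 to the earlier
holes have become as rare as their mass dictates, it is too narrow to contain the
points of that orbit before this time, and it lasts [k] times as long. *)
Definition admissible_hole (s : seq X) (x : X) := let k := size s in
  [/\ (k < x.1.1)%N, forall x', x' \in s -> (x'.1.1 <= x.1.1)%N, x.1.2 = (k * x.1.1)%N,
    visit_average g (holes_closure s) 0 x.1.1 <= mass (holes_closure s) + k.+1%:R^-1 &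
    (forall i j, (i < x.1.1)%N -> (j < x.1.2)%N ->
      ~ island V (g *+ (x.1.1 + j)) x.2 (g *+ i)) /\
    mass (hole_closure x) <= 2^-1 ^+ (k + 2)].

Lemma exists_admissible_hole s : exists x, admissible_hole s x.
Proof.
set k := size s.
have k0 : 0 < k.+1%:R^-1 :> R by rewrite invr_gt0.
have [N NP] := visit_upper_bound H (@closed_seq_union _ _ _ s closed_hole) k0.
have [M MP] : exists M, forall x', x' \in s -> (x'.1.1 <= M)%N.
  exists (\max_(x' <- s) x'.1.1)%N => x' x's.
  by rewrite (big_rem x' x's) leq_maxl.
pose a := maxn (maxn N M) k.+1; pose L := (k * a)%N.
have n1 : \forall n \near \oo, forall i, i \in iota 0 a -> forall j, j \in iota 0 L ->
    ~ island V (g *+ (a + j)) n (g *+ i).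
  apply: near_all_seq => i; rewrite mem_iota add0n => /andP[_ ia].
  apply: near_all_seq => j _.
  have oi : open (~` [set g *+ i]) by apply: closed_openC; exact: (closed1 H).
  have : (~` [set g *+ i]) (g *+ (a + j)).
    move=> /= E; have d0 : (0 < a + j - i)%N by lia.
    have := natmul_neq0 H d0; rewrite mulrnBr ?E ?subrr ?eqxx//; lia.
  by move=> /(near_island bV oi); apply: filterS => n nI h; exact: (nI _ h erefl).
have e0 : 0 < 2^-1 ^+ (k + 2) / L.+1%:R :> R.
  by rewrite divr_gt0// exprn_gt0// invr_gt0.
have n2 := near_mass_base H bV e0.
have [n [N1 N2]] := filter_ex (filterI n1 n2).
exists (a, L, n); rewrite /admissible_hole -/k; split => //=.
- by rewrite leq_maxr.
- by move=> x' /MP /leq_trans; apply; rewrite /a; lia.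
- by apply: NP; rewrite /a; lia.
- split; first by move=> i j ia jL; apply: N1; rewrite mem_iota add0n.
  apply: le_trans (mass_hole_le _) _ => /=.
  apply: le_trans (_ : L.+1%:R * mass (closure (V n)) <= _).
    by rewrite ler_wpM2r ?mass_ge0// ler_nat.
  by rewrite mulrC -ler_pdivlMr// ltW.
Qed.

(** The complement of all the holes. Along the orbit of 0, the averages are close to the
mass of the set when a hole opens, and close to 0 when it closes. *)
Lemma exists_maximal_set : exists C : set T, [/\ closed C, 0 < mass C,
  forall O, open O -> O !=set0 -> O `\` C !=set0 & maximal_frequencies g C m].
Proof.
have [f fP] := history_choice exists_admissible_hole.
have {}fP k := fP k : admissible_hole (mkseq f k) (f k).
rewrite /admissible_hole in fP.
pose C := ~` \bigcup_k hole (f k).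
have oH k : open (hole (f k)).
  by apply: bigcup_open => i _; exact: (open_island_core bV).
have cC : closed C by apply: open_closedC; exact: bigcup_open.
have sub k : hole (f k) `<=` hole_closure (f k).
  by move=> u [i iL ui]; exists i => //; exact: island_core_sub.
have start k l : (k <= l)%N -> ((f k).1.1 <= (f l).1.1)%N.
  rewrite leq_eqVlt => /orP[/eqP -> //|kl].
  by have [_ + _ _ _] := fP l; apply; exact: mem_mkseq_lt.
have mH k : borel_set (hole (f k)) by exact: open_borel.
have holes_small : mass (\bigcup_k hole (f k)) <= 2^-1.
  apply: mass_bigcup_le => // N.
  have : \sum_(i < N) mass (hole (f i)) <= \sum_(i < N) 2^-1 ^+ (i + 2).
    apply: ler_sum => i _; have [_ _ _ _ [_]] := fP i; rewrite size_mkseq.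
    apply: le_trans.
    by apply: mass_mono => //; apply: closed_borel; exact: closed_hole.
  by move=> /le_trans; apply; exact: sum_half_powers.
have mU : borel_set (\bigcup_k hole (f k)).
  by apply: bigcup_measurable => k _; exact: mH.
have mC : mass C = 1 - mass (\bigcup_k hole (f k)) by exact: massC.
exists C; split => //.
- rewrite mC; lra.
- move=> O oO O0; have [K KP] := uniform_hitting H oO O0.
  have [sk _ Lk _ _] := fP K.+1; rewrite size_mkseq in sk Lk.
  have [i iK Oi] := KP (g *+ (f K.+1).1.1).
  exists (g *+ ((f K.+1).1.1 + i)); split; first by rewrite mulrnDr.
  apply; exists K.+1 => //; exists i; last first.
    by rewrite /island_core/= subrr; exact: (base0 bV).
  by rewrite /= Lk; nia.
(* The closures of the holes exceed the holes by a null set. *)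
pose S := \bigcup_i \bigcup_n shore V (g *+ i) n.
have mS : borel_set S.
  by apply: bigcup_measurable => i _; apply: bigcup_measurable => n _;
    apply: closed_borel; exact: (closed_shore bV).
have S0 : mass S = 0.
  apply: mass_bigcup0 => i.
    by apply: bigcup_measurable => n _; apply: closed_borel; exact: (closed_shore bV).
  apply: mass_bigcup0 => n; last exact: (mass_shore H bV).
  by apply: closed_borel; exact: (closed_shore bV).
apply: (oscillation_maximal H cC (x := 0)) => e N /(exists_small_inverse N)[k Nk ke];
    have [sk _ Lk ak [nI _]] := fP k; rewrite size_mkseq in sk Lk ak.
  set a := (f k).1.1 in sk Lk ak nI; set L := (f k).1.2 in Lk nI.
  exists (a + L)%N; first by lia.
  have aL0 : 0 < (a + L)%:R :> R by rewrite ltr0n; lia.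
  apply: le_lt_trans ke; rewrite /visit_average mulrC ler_pdivrMr//.
  have : \sum_(i < a + L) \1_C (0 + g *+ i) <= a%:R :> R.
    have count n : (\sum_(i < n) (i < a) <= a)%N.
      elim: n => [|n ih]; first by rewrite big_ord0.
      rewrite big_ord_recr/=; case: ltnP => [na|an]; last by rewrite addn0.
      rewrite (eq_bigr (fun=> 1%N)); last first.
        by move=> i _; rewrite (ltn_trans (ltn_ord i) na).
      by rewrite sum1_card card_ord addn1.
    apply: le_trans (_ : (\sum_(i < a + L) (i < a))%:R <= _); last by rewrite ler_nat.
    rewrite natr_sum; apply: ler_sum => i _; have [ia|ai] := ltnP i a.
      by case/andP: (@indic01 R _ C (0 + g *+ i)).
    rewrite indicE memNset//; apply; exists k => //; exists (i - a)%N.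
      by rewrite /= -/L; have := ltn_ord i; lia.
    by rewrite /island_core/= -/a subnKC// add0r subrr; exact: (base0 bV).
  move=> /le_trans; apply.
  by rewrite Lk -mulSn natrM mulrA mulVf ?mul1r// pnatr_eq0.
exists (f k).1.1; first exact: leq_trans Nk (ltnW sk).
have cR : closed (holes_closure (mkseq f k)).
  by apply: closed_seq_union; exact: closed_hole.
have mR := closed_borel cR.
have s0 : (f k).1.1%:R != 0 :> R by rewrite pnatr_eq0 -lt0n (leq_trans _ sk).
have cover1 : 1 <= visit_average g C 0 (f k).1.1 +
    visit_average g (holes_closure (mkseq f k)) 0 (f k).1.1 :> R.
  rewrite !visit_averageE -big_split/=.
  have E : 1 = \sum_(i < (f k).1.1) (f k).1.1%:R^-1 :> R.
    by rewrite sumr_const card_ord -[RHS]mulr_natr mulVf.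
  rewrite [leLHS]E.
  apply: ler_sum => i _; rewrite -mulrDr ler_peMr ?invr_ge0//.
  have [Ci|nCi] := pselect (C (0 + g *+ i)).
    by rewrite indicE mem_set// lerDl.
  rewrite [X in _ + X]indicE mem_set ?lerDr//.
  have [l _ [j jL lj]] := contrapT nCi.
  have [lk|kl] := ltnP l k.
    by exists (f l); [exact: mem_mkseq_lt|exists j => //; exact: island_core_sub].
  have [_ _ _ _ [nIl _]] := fP l; exfalso.
  apply: (nIl i j (leq_trans (ltn_ord i) (start _ _ kl)) jL).
  by have := island_core_sub lj; rewrite add0r.
have massR : mass (holes_closure (mkseq f k)) <= 1 - mass C.
  rewrite mC opprB addrC subrK -[leRHS]addr0 -S0.
  apply: le_trans (massU_le m mU mS); apply: mass_mono => //; first exact: measurableU.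
  move=> u [x /mapP[l _ ->] [i iL ui]].
  have [ci|nci] := pselect (island_core V (g *+ ((f l).1.1 + i)) (f l).2 u).
    by left; exists l => //; exists i.
  by right; exists ((f l).1.1 + i)%N => //; exists (f l).2.
move: ke ak; set q := _^-1 => ke ak; lra.
Qed.

End OscillatingOrbit.

(** * A nowhere dense set with a gap in its frequencies *)

Section Weights.
Context {R : realType}.

(** For a power of [i] with an exponent between -1 and 0, the average over the times
before [n] is comparable with the value at [n]: this is the mechanism behind
[sum_weight_le]. *)
Definition decay (i : nat) : R := (Num.sqrt i.+1%:R)^-1.

Lemma decay_ge0 i : 0 <= decay i.
Proof. by rewrite invr_ge0 sqrtr_ge0. Qed.

Lemma decay_le (i : nat) : decay i <= 2 * (Num.sqrt i.+1%:R - Num.sqrt i%:R).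
Proof.
have s1 : 0 < Num.sqrt i.+1%:R :> R by rewrite sqrtr_gt0.
have s0 : 0 <= Num.sqrt i%:R :> R by exact: sqrtr_ge0.
have e1 : Num.sqrt i.+1%:R ^+ 2 = i%:R + 1 :> R by rewrite sqr_sqrtr// natr1.
have e0 : Num.sqrt i%:R ^+ 2 = i%:R :> R by rewrite sqr_sqrtr.
rewrite /decay -[leLHS]mul1r ler_pdivrMr//.
move: s1 s0 e1 e0; set a := Num.sqrt _; set b := Num.sqrt _; nra.
Qed.

(** The contribution of a hit at time [m] to the weight at time [k]. *)
Definition hit_decay (L m k : nat) : R := if (k <= m < k + L)%N then decay (m - k) else 0.

(** The sum telescopes by [decay_le]. *)
Lemma sum_hit_decay_le L m n :
  \sum_(k < n) hit_decay L m k <=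
  2 * (Num.sqrt (minn L m.+1)%:R - Num.sqrt (minn L (m.+1 - n))%:R).
Proof.
elim: n => [|n ih]; first by rewrite big_ord0 subn0 subrr mulr0.
rewrite big_ord_recr/=.
suff : hit_decay L m n <= 2 *
  (Num.sqrt (minn L (m.+1 - n))%:R - Num.sqrt (minn L (m.+1 - n.+1))%:R) by lra.
rewrite /hit_decay; case: ifP => [/andP[nm mnL]|_].
  have -> : (minn L (m.+1 - n) = (m - n).+1)%N by lia.
  have -> : (minn L (m.+1 - n.+1) = m - n)%N by lia.
  exact: decay_le.
rewrite mulr_ge0// subr_ge0 ler_wsqrtr// ler_nat; lia.
Qed.

Lemma sum_hit_decay_bound L m n : (0 < L)%N ->
  \sum_(k < n) hit_decay L m k <= 2 * n%:R * (Num.sqrt (minn L m.+1)%:R)^-1.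
Proof.
move=> L0; apply: le_trans (sum_hit_decay_le L m n) _.
set b := minn L m.+1; set a := minn L (m.+1 - n).
have b0 : 0 < Num.sqrt b%:R :> R by rewrite sqrtr_gt0 ltr0n /b; lia.
rewrite ler_pdivlMr//.
have ab : Num.sqrt a%:R <= Num.sqrt b%:R :> R by rewrite ler_wsqrtr// ler_nat /a /b; lia.
have ban : b%:R <= a%:R + n%:R :> R by rewrite -natrD ler_nat /a /b; lia.
have e1 : Num.sqrt b%:R ^+ 2 = b%:R :> R by rewrite sqr_sqrtr.
have e0 : Num.sqrt a%:R ^+ 2 = a%:R :> R by rewrite sqr_sqrtr.
have a0 : 0 <= Num.sqrt a%:R :> R by exact: sqrtr_ge0.
move: b0 ab ban e1 e0 a0; set x := Num.sqrt b%:R; set y := Num.sqrt a%:R.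
set u := b%:R; set v := a%:R; set w := n%:R; nra.
Qed.

Definition hits_ahead (L : nat) (b : nat -> bool) (k : nat) : R :=
  \sum_(i < L) decay i * (b (k + i)%N)%:R.

Lemma hits_aheadE L b k M : (k + L <= M)%N ->
  hits_ahead L b k = \sum_(m < M) (b m)%:R * hit_decay L m k.
Proof.
move=> kLM; rewrite -(subnKC kLM) -addnA big_split_ord/= big1 ?add0r; last first.
  by move=> i _; rewrite /hit_decay leqNgt ltn_ord/= mulr0.
rewrite big_split_ord/= [X in _ = _ + X]big1 ?addr0; last first.
  move=> i _; rewrite /hit_decay addnA; case: ifP; rewrite ?mulr0// => /andP[_]; lia.
apply: eq_bigr => i _; rewrite /hit_decay mulrC; congr (_ * _).
by rewrite leq_addr ltn_add2l ltn_ord addKn.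
Qed.

Lemma sum_hits_aheadE L b n :
  \sum_(k < n) hits_ahead L b k = \sum_(m < n + L) (b m)%:R * \sum_(k < n) hit_decay L m k.
Proof.
rewrite (eq_bigr (fun k : 'I_n => \sum_(m < n + L) (b m)%:R * hit_decay L m k)).
  by rewrite exchange_big/=; apply: eq_bigr => m _; rewrite mulr_sumr.
by move=> k _; apply: hits_aheadE; rewrite leq_add2r ltnW.
Qed.

Variables (l : nat) (b : nat -> bool).
Hypothesis l0 : (0 < l)%N.
Hypothesis sb : forall i j, (i < j)%N -> b i -> b j -> (l ^ 2 <= j - i)%N.

Let L := (l ^ 2)%N.

Lemma sqrtL : Num.sqrt L%:R = l%:R :> R.
Proof. by rewrite /L natrX sqrtr_sqr ger0_norm. Qed.

Lemma hits_le a n : (L * (\sum_(i < n) b (a + i)) <= n + L.-1)%N.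
Proof.
have L0 : (0 < L)%N by rewrite expn_gt0 l0.
have := @sparse_count (fun i => b (a + i)%N) L.-1 n; rewrite prednK// => h.
apply: h; move=> i j ij bi bj.
by have := sb _ bi bj; rewrite subnDl; apply; rewrite ltn_add2l.
Qed.

(** A window of length at most [L] meets one hit before time [L] and one after, at most. *)
Lemma sum_hits_ahead_short n : (n <= L)%N ->
  \sum_(k < n) hits_ahead L b k <= 2 * n%:R * (hits_ahead L b 0 + l%:R^-1).
Proof.
move=> nL; have L0 : (0 < L)%N by rewrite expn_gt0 l0.
rewrite sum_hits_aheadE addnC big_split_ord/= mulrDr; apply: lerD.
  rewrite /hits_ahead mulr_sumr; apply: ler_sum => m _; rewrite add0n.
  have [bm|_] := boolP (b m); last by rewrite mul0r !mulr0.
  rewrite mul1r mulr1; apply: le_trans (sum_hit_decay_bound m n L0) _.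
  by have -> : minn L m.+1 = m.+1 by have := ltn_ord m; lia.
apply: le_trans (_ : \sum_(i < n) (b (L + i)%N)%:R * (2 * n%:R * l%:R^-1) <= _).
  apply: ler_sum => i _; apply: ler_wpM2l => //.
  apply: le_trans (sum_hit_decay_bound _ n L0) _.
  have -> : minn L (L + i).+1 = L by lia.
  by rewrite sqrtL.
rewrite -mulr_suml -natr_sum; apply: ler_piMl; first by rewrite !mulr_ge0// invr_ge0.
rewrite -[1]/(1%:R) ler_nat.
have := hits_le L n; case: (\sum_(i < n) _)%N => [//|[//|s]].
by rewrite mulnSr mulnSr; lia.
Qed.

Lemma sum_hits_ahead_long n : (L <= n)%N ->
  \sum_(k < n) hits_ahead L b k <= 6 * n%:R * l%:R^-1.
Proof.
move=> Ln; have L0 : (0 < L)%N by rewrite expn_gt0 l0.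
have l0' : 0 < l%:R :> R by rewrite ltr0n.
rewrite sum_hits_aheadE.
apply: le_trans (_ : \sum_(m < n + L) (b m)%:R * (2 * l%:R) <= _).
  apply: ler_sum => m _; apply: ler_wpM2l => //.
  apply: le_trans (sum_hit_decay_le L m n) _; rewrite ler_pM2l//.
  apply: le_trans (_ : Num.sqrt (minn L m.+1)%:R <= _).
    by rewrite gerBl sqrtr_ge0.
  by rewrite -sqrtL ler_wsqrtr// ler_nat geq_minl.
rewrite -mulr_suml -natr_sum ler_pdivlMr//.
have : (L * (\sum_(i < n + L) b i) <= n + L + L.-1)%N := hits_le 0 (n + L).
set s := (\sum_(i < n + L) b i)%N => hs.
have : (L * s)%:R <= (3 * n)%:R :> R by rewrite ler_nat; lia.
rewrite /L !natrM; set x := l%:R; set y := s%:R; set w := n%:R; nra.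
Qed.

(** The weight at time [k] of a sequence of hits [b] that are at least [L = l ^ 2] steps
apart: the hit within the next [L] steps, discounted by its distance, plus a floor
that is the smallest value of the discount. *)
Definition weight (k : nat) : R := l%:R^-1 + hits_ahead L b k.

Lemma sum_weight n : \sum_(k < n) weight k = n%:R * l%:R^-1 + \sum_(k < n) hits_ahead L b k.
Proof. by rewrite big_split/= sumr_const card_ord mulr_natl. Qed.

Lemma hits_ahead_ge0 k : 0 <= hits_ahead L b k.
Proof. by apply: sumr_ge0 => i _; rewrite mulr_ge0// decay_ge0. Qed.

Lemma sum_weight_long n : (L <= n)%N -> \sum_(k < n) weight k <= 7 * n%:R * l%:R^-1.
Proof.
move=> /sum_hits_ahead_long; rewrite sum_weight.
set x := \sum_(k < n) _; set q := l%:R^-1; set w := n%:R => h; lra.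
Qed.

(** A one-sided Muckenhoupt condition: at all times the average of the weights is at
most a constant times the weight at the start, with a constant that does not depend
on [l]. The next hit contributes according to [sum_hit_decay_bound], and later
ones are so sparse that they are dominated by the floor [1 / l]. *)
Lemma sum_weight_le n : \sum_(k < n) weight k <= 7 * n%:R * weight 0.
Proof.
have t0 := hits_ahead_ge0 0.
have q0 : 0 <= l%:R^-1 :> R by rewrite invr_ge0.
have [nL|/ltnW Ln] := leqP n L.
  have := sum_hits_ahead_short nL; rewrite sum_weight /weight.
  have : 0 <= n%:R * hits_ahead L b 0 by rewrite mulr_ge0.
  have : 0 <= n%:R * l%:R^-1 :> R by rewrite mulr_ge0.
  set x := \sum_(k < n) _; set q := l%:R^-1; set w := n%:R; set t := hits_ahead _ _ _.
  lra.
apply: le_trans (sum_weight_long Ln) _; rewrite ler_wpM2l ?mulr_ge0//.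
by rewrite /weight lerDl.
Qed.

End Weights.

Section SparseSet.
Context {R : realType} {T : topologicalZmodType} {g : T}.
Context {m : probability (borel T) R} (H : haar_rotation g m).
Context (V : nat -> set T).
Hypothesis bV : null_base (m := m) V.
Local Notation mass := (mass m).

(** Any rapidly increasing sequence would do; the factor 100 makes [sum_gauge] small. *)
Definition gauge (j : nat) : nat := 100 * 2 ^ j.

Lemma gauge_gt0 j : (0 < gauge j)%N.
Proof. by rewrite /gauge muln_gt0 expn_gt0. Qed.

Lemma gauge_le i j : (i <= j)%N -> (gauge i <= gauge j)%N.
Proof. by move=> ij; rewrite /gauge leq_pmul2l// leq_exp2l. Qed.

Lemma exists_sparse_balls : exists n : nat -> nat, forall j u d,
  (0 < d < gauge j ^ 2)%N -> island_core V (g *+ j) (n j) u ->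
  ~ island_core V (g *+ j) (n j) (u + g *+ d).
Proof.
suff /choice[n nP] j : exists n, forall u d, (0 < d < gauge j ^ 2)%N ->
    island_core V (g *+ j) n u -> ~ island_core V (g *+ j) n (u + g *+ d).
  by exists n.
have : \forall n \near \oo, forall d, d \in iota 1 (gauge j ^ 2) ->
    forall u v, closure (V n) u -> closure (V n) v -> u - v != g *+ d.
  apply: near_all_seq => d; rewrite mem_iota => /andP[d0 _].
  exact: (near_difference H bV (natmul_neq0 H d0)).
move=> /filter_ex[n nP]; exists n => u d /andP[d0 dk] ku kud.
have dI : d \in iota 1 (gauge j ^ 2) by rewrite mem_iota d0 add1n ltnS ltnW.
have := nP d dI _ _ (island_core_sub kud) (island_core_sub ku).
by rewrite subr_eq addrA [_ *+ _ + u]addrC eqxx.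
Qed.

Context (n : nat -> nat).
Hypothesis sparse : forall j u d, (0 < d < gauge j ^ 2)%N ->
  island_core V (g *+ j) (n j) u -> ~ island_core V (g *+ j) (n j) (u + g *+ d).

Let B j := island_core V (g *+ j) (n j).
Let hit t j k := t + g *+ k \in B j.

(** The weight w_j, as a function on the group. *)
Definition load (j : nat) (t : T) : R := weight (gauge j) (hit t j) 0.
Definition total (J : nat) (t : T) : R := \sum_(j < J) load j t.
Definition light := [set t | forall J, total J t <= 1].

Lemma load_shift j t k : load j (t + g *+ k) = weight (gauge j) (hit t j) k.
Proof.
rewrite /load /weight /hits_ahead; congr (_ + _); apply: eq_bigr => i _.
by rewrite /hit add0n mulrnDr addrA.
Qed.

Lemma hit_sparse t j a b :
  (a < b)%N -> hit t j a -> hit t j b -> (gauge j ^ 2 <= b - a)%N.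
Proof.
move=> ab; rewrite /hit !inE => Ba Bb; rewrite leqNgt; apply/negP => bag.
have d0 : (0 < b - a < gauge j ^ 2)%N by rewrite subn_gt0 ab.
by have := sparse d0 Ba; rewrite -addrA -mulrnDr subnKC ?(ltnW ab).
Qed.

Lemma load_ge0 j t : 0 <= load j t.
Proof. by rewrite /load /weight addr_ge0 ?invr_ge0// hits_ahead_ge0. Qed.

Lemma total_le J J' t : (J <= J')%N -> total J t <= total J' t.
Proof.
move=> JJ; rewrite -(subnKC JJ) /total big_split_ord/= lerDl.
by apply: sumr_ge0 => i _; exact: load_ge0.
Qed.

Lemma sum_load_le j t k : \sum_(i < k) load j (t + g *+ i) <= 7 * k%:R * load j t.
Proof.
rewrite (eq_bigr (fun i : 'I_k => weight (gauge j) (hit t j) i)).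
  by apply: sum_weight_le; [exact: gauge_gt0|exact: hit_sparse].
by move=> i _; exact: load_shift.
Qed.

Lemma sum_gauge J : \sum_(j < J) (gauge j)%:R^-1 <= 1 / 50 :> R.
Proof.
have -> : \sum_(j < J) (gauge j)%:R^-1 = 1 / 50 * (1 - 2^-1 ^+ J) :> R.
  elim: J => [|J ih]; first by rewrite big_ord0 expr0 subrr mulr0.
  rewrite big_ord_recr/= ih exprS /gauge natrM natrX invfM -exprVn.
  set q := _ ^+ J; lra.
have := exprn_ge0 J (_ : 0 <= 2^-1 :> R); rewrite invr_ge0 ler0n => /(_ isT).
set q := _ ^+ J; lra.
Qed.

Lemma sum_total_long J t k : (gauge J ^ 2 <= k)%N ->
  \sum_(i < k) total J (t + g *+ i) <= k%:R * (7 / 50).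
Proof.
move=> Jk; rewrite exchange_big/=.
apply: le_trans (_ : \sum_(j < J) 7 * k%:R * (gauge j)%:R^-1 <= _).
  apply: ler_sum => j _.
  rewrite (eq_bigr (fun i : 'I_k => weight (gauge j) (hit t j) i)).
    apply: sum_weight_long; [exact: gauge_gt0|exact: hit_sparse|].
    by apply: leq_trans Jk; rewrite leq_exp2r// gauge_le// ltnW.
  by move=> i _; exact: load_shift.
rewrite -mulr_sumr [7 * _]mulrC -mulrA ler_wpM2l//.
have := sum_gauge J; lra.
Qed.

Lemma open_total J : open [set t | 1 < total J t].
Proof.
rewrite openE => t /= t1; rewrite /interior.
have loads j : \forall u \near t, load j t <= load j u.
  have : \forall u \near t, forall i, (i < gauge j ^ 2)%N -> (hit t j i <= hit u j i)%N.
    elim: (gauge j ^ 2)%N => [|N ih]; first by apply: nearW => u i; rewrite ltn0.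
    have step : \forall u \near t, (hit t j N <= hit u j N)%N.
      have [hN|nhN] := boolP (hit t j N); last exact: nearW.
      move: hN; rewrite /hit inE => hN.
      have : \forall u \near t, B j (u + g *+ N).
        apply: open_nbhs_nbhs; split => //.
        by apply: (@open_shift _ _ (B j)); exact: (open_island_core bV).
      by apply: filterS => u Bu; rewrite (mem_set Bu).
    apply: filterS2 step ih => u uN ui i.
    by rewrite ltnS leq_eqVlt => /orP[/eqP -> //|]; exact: ui.
  apply: filterS => u uP; rewrite /load /weight lerD2l; apply: ler_sum => i _.
  by apply: ler_wpM2l; [exact: decay_ge0|rewrite ler_nat add0n; exact: uP].
have : \forall u \near t, total J t <= total J u.
  rewrite /total; elim: J {t1} => [|J ih]; first by apply: nearW => u; rewrite !big_ord0.
  by apply: filterS2 ih (loads J) => u h1 h2; rewrite !big_ord_recr/= lerD.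
by apply: filterS => u /=; exact: lt_le_trans.
Qed.

Lemma closed_total J : closed [set t | total J t <= 1].
Proof.
rewrite -openC; have := open_total J; congr open.
by apply/seteqP; split => t /=; rewrite ltNge => /negP.
Qed.

Lemma closed_light : closed light.
Proof.
have -> : light = \bigcap_J [set t | total J t <= 1].
  by apply/seteqP; split => t tP J; [move=> _; exact: tP|exact: tP].
by apply: closed_bigI => J _; exact: closed_total.
Qed.

Lemma light_nonempty : light !=set0.
Proof.
have [||||t tP] := @nested_closed_nonempty _ (fun J => [set t | total J t <= 1]).
- exact: (rot_compact H).
- exact: closed_total.
- by move=> J t /=; apply: le_trans; exact: total_le.
- move=> J; apply: contrapT => none.
  have big t : 1 < total J t.
    by rewrite ltNge; apply/negP => tJ; apply: none; exists t.
  pose k := (gauge J ^ 2)%N.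
  have k0 : 0 < k%:R :> R by rewrite ltr0n expn_gt0 gauge_gt0.
  have := sum_total_long 0 (leqnn k).
  have : \sum_(i < k) 1 <= \sum_(i < k) total J (0 + g *+ i).
    by apply: ler_sum => i _; exact: ltW.
  rewrite sumr_const card_ord; move: k0; set w := k%:R; set x := \sum_(i < k) _; lra.
- by exists t.
Qed.

(** The load [j] exceeds 1 at the centre [g *+ j] of the [j]-th ball, and the forward
orbit of 0 is dense. *)
Lemma light_meagre O : open O -> O !=set0 -> O `\` light !=set0.
Proof.
move=> oO O0; have [K /(_ 0) [k _ Ok]] := uniform_hitting H oO O0.
exists (0 + g *+ k); split => // /(_ k.+1); apply/negP; rewrite -ltNge.
apply: (@lt_le_trans _ _ (load k (0 + g *+ k))); last first.
  by rewrite /total big_ord_recr/= lerDr; apply: sumr_ge0 => i _; exact: load_ge0.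
have L0 : (0 < gauge k ^ 2)%N by rewrite expn_gt0 gauge_gt0.
rewrite /load /weight /hits_ahead -(prednK L0) big_ord_recl.
have -> : hit (0 + g *+ k) k (0 + ord0 (n' := (gauge k ^ 2).-1))%N.
  by rewrite /hit inE /B /island_core/= mulr0n addr0 add0r subrr; exact: (base0 bV).
rewrite /decay sqrtr1 invr1 mulr1 addrA ltr_wpDr//.
  by apply: sumr_ge0 => i _; rewrite mulr_ge0// invr_ge0 sqrtr_ge0.
by rewrite ltrDr invr_gt0 ltr0n gauge_gt0.
Qed.

(** The totals are bounded by 1, so they cannot increase by 1/28 more than 28 times. *)
Lemma light_tail t : light t -> exists J, forall J', total J' t <= total J t + 1 / 28.
Proof.
move=> tl; apply: contrapT => /forallNP h.
have grow r : exists J, r%:R * (1 / 28) <= total J t.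
  elim: r => [|r [J rJ]]; first by exists 0%N; rewrite mul0r /total big_ord0.
  have /existsNP[J' /negP] := h J; rewrite -ltNge => J'J; exists J'.
  by rewrite -natr1; lra.
by have [J] := grow 29%N; have := tl J; lra.
Qed.

(** At a light point the loads have a finite sum, so that all but finitely many of them
are small altogether, and by [sum_load_le] they stay small on average at all
times. The finitely many others have small averages in the long run. A total load
whose average is at most 1/2 is at most 1 for at least half of the time. *)
Lemma light_frequency t : light t ->
  exists N, forall k, (N <= k)%N -> 1 / 2 <= visit_average g light t k :> R.
Proof.
move=> /light_tail[J JP]; exists (gauge J ^ 2)%N => k Jk.
have k0 : 0 < k%:R :> R.
  by rewrite ltr0n (leq_trans _ Jk)// expn_gt0 gauge_gt0.
have [J' [JJ' J'P]] : exists J', (J <= J')%N /\ forall i, (i < k)%N ->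
    1 <= \1_light (t + g *+ i) + total J' (t + g *+ i).
  elim: (k) => [|k' [J1 [JJ1 J1P]]]; first by exists J.
  have [J2 J2P] : exists J2, 1 <= \1_light (t + g *+ k') + total J2 (t + g *+ k').
    have [li|/existsNP[J2 /negP]] := pselect (light (t + g *+ k')).
      by exists 0%N; rewrite indicE mem_set// /total big_ord0 addr0.
    rewrite -ltNge => J2P; exists J2.
    rewrite (le_trans (ltW J2P))// lerDr.
    by case/andP: (@indic01 R _ light (t + g *+ k')).
  exists (maxn J1 J2); split; first by rewrite (leq_trans JJ1)// leq_maxl.
  move=> i; rewrite ltnS leq_eqVlt => /orP[/eqP ->|/J1P h].
    by apply: le_trans J2P _; rewrite lerD2l total_le// leq_maxr.
  by apply: le_trans h _; rewrite lerD2l total_le// leq_maxl.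
have all_k : k%:R <=
    \sum_(i < k) \1_light (t + g *+ i) + \sum_(i < k) total J' (t + g *+ i) :> R.
  rewrite -big_split/= -[leLHS]mulr1 mulr_natl -[X in _ *+ X]card_ord -sumr_const.
  by apply: ler_sum => i _; exact: J'P.
have tail : \sum_(i < k) total J' (t + g *+ i) <=
    \sum_(i < k) total J (t + g *+ i) + 7 * k%:R * (total J' t - total J t).
  have split_total u : total J' u = total J u + \sum_(j < J' - J) load (J + j) u.
    by rewrite -[in LHS](subnKC JJ') /total big_split_ord.
  rewrite split_total [total J t + _]addrC addrK.
  under [X in X <= _]eq_bigr do rewrite split_total.
  rewrite big_split/= lerD2l exchange_big/= mulr_sumr.
  by apply: ler_sum => j _; exact: sum_load_le.
(* The averages of the total load are at most 7 / 50 + 7 / 28 <= 1 / 2. *)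
rewrite -(ler_pM2l k0) visit_sumE.
have := sum_total_long t Jk; have := JP J'.
move: all_k tail; set s := \sum_(i < k) \1_light _; set p := \sum_(i < k) total J' _.
set q := \sum_(i < k) total J _; set w := k%:R; set x := total J' t; set y := total J t.
move=> h1 h2 h3 h4.
have : w * (x - y) <= w * (1 / 28) by rewrite ler_pM2l//; lra.
nra.
Qed.

Lemma mass_light : 1 / 2 <= mass light.
Proof.
have [t tl] := light_nonempty; have [N NP] := light_frequency tl.
apply/ler_addgt0Pr => e e0; have [N' N'P] := visit_upper_bound H closed_light e0.
apply: le_trans (NP (maxn N N') (leq_maxl _ _)) _.
by apply: N'P; exact: leq_maxr.
Qed.

(** If an orbit visits the set at all, then it does so about half of the time at least,
so that 1/4 is not a frequency. *)
Lemma light_not_maximal : ~ maximal_frequencies g light m.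
Proof.
have l2 := mass_light.
move=> maxl; have : visit_frequencies g light (1 / 4 : R).
  by rewrite maxl /= in_itv/=; apply/andP; split; [lra|rewrite -/(mass light); lra].
move=> [t _ [_ /accumulationP acc]].
have e0 : 0 < 1 / 20 :> R by lra.
have [[a la]|nl] := pselect (exists a, light (t + g *+ a)); last first.
  have [k _] := acc _ 0%N e0; rewrite /visit_average big1.
    by rewrite mulr0 subr0 ger0_norm; lra.
  by move=> i _; rewrite indicE memNset// => li; apply: nl; exists i.
have [N NP] := light_frequency la.
have [k kN] := acc _ (a + maxn N (2 * a).+1)%N e0.
pose k' := (k - a)%N; have kE : k = (a + k')%N by rewrite /k' subnKC//; lia.
have Nk' : (N <= k')%N by rewrite /k'; lia.
have ak' : (2 * a < k')%N by rewrite /k'; lia.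
have := NP k' Nk'.
have k'0 : 0 < k'%:R :> R by rewrite ltr0n; lia.
have k0 : 0 < k%:R :> R by rewrite ltr0n; lia.
rewrite -(ler_pM2l k'0) visit_sumE => h1.
have h2 : \sum_(i < k') \1_light (t + g *+ a + g *+ i) <=
    k%:R * visit_average g light t k :> R.
  rewrite visit_sumE kE big_split_ord/= ler_wpDl//; first by apply: sumr_ge0.
  by apply: ler_sum => i _; rewrite mulrnDr addrA.
have h3 : k%:R <= 3 / 2 * k'%:R :> R.
  have : (2 * k)%:R <= (3 * k')%:R :> R by rewrite ler_nat; lia.
  by rewrite !natrM; lra.
rewrite ltr_norml => /andP[h4 _].
have h5 : k%:R * visit_average g light t k < k%:R * (3 / 10) :> R.
  rewrite ltr_pM2l//; lra.
move: h1 h2 h3 h5; set s := \sum_(i < k') _; lra.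
Qed.

End SparseSet.

Lemma exists_non_maximal_set (R : realType) (T : topologicalZmodType) (g : T)
    (m : probability (borel T) R) : haar_rotation g m ->
  exists C : set T, [/\ closed C, C !=set0, 0 < mass m C,
    forall O, open O -> O !=set0 -> O `\` C !=set0 & ~ maximal_frequencies g C m].
Proof.
move=> H; have [V bV] := exists_null_base H.
have [n sparse] := exists_sparse_balls H bV.
exists (light (R := R) (g := g) V n); split.
- exact: closed_light bV n.
- exact: (light_nonempty H bV sparse).
- by apply: lt_le_trans (mass_light H bV sparse); lra.
- exact: (light_meagre H bV).
- exact: (light_not_maximal H bV sparse).
Qed.

Theorem theorem6p1 (R : realType) (T : topologicalZmodType) (g : T)
    (m : probability (borel T) R)
    (T_compact : compact [set: T]) (T_metrizable : metrizable R T)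
    (T_infinite : infinite_set [set: T]) (T_monothetic : monothetic T)
    (g_minimal : minimal_rotation g) (m_haar : normalized_haar m) :
  [/\ exists (p : nat) (W : 'I_p -> set T),
        [/\ separating_cover g W,
            (0 < m (cover_boundary W))%E &
            maximal_frequencies g (cover_boundary W) m],
      exists (p : nat) (W' : 'I_p -> set T),
        [/\ separating_cover g W',
            (0 < m (cover_boundary W'))%E &
            ~ maximal_frequencies g (cover_boundary W') m] &
      forall (p : nat) (W : 'I_p -> set T) (pi : symbolic_space p -> T),
        separating_cover g W ->
        almost_1to1_factor_map g W pi ->
        (forall theta : T, (fibre g W pi theta #<= `I_2)%card) ->
        maximal_frequencies g (cover_boundary W) m].
Proof.
have H : haar_rotation g m by [].
split.
- have [V bV] := exists_null_base H.
  have [C [cC C0 C_meagre C_max]] := exists_maximal_set H bV.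
  have [W [Wsep mW WC]] := exists_cover_with_boundary H cC (mass_gt0_nonempty C0) C_meagre.
  exists 2%N, W; split => //.
    by rewrite mW massE ?lte_fin//; exact: closed_borel.
  by rewrite /maximal_frequencies WC mW.
- have [C [cC Cn0 C0 C_meagre C_max]] := exists_non_maximal_set H.
  have [W [Wsep mW WC]] := exists_cover_with_boundary H cC Cn0 C_meagre.
  exists 2%N, W; split => //.
    by rewrite mW massE ?lte_fin//; exact: closed_borel.
  by rewrite /maximal_frequencies WC mW.
- move=> p W pi; exact: two_point_fibres_maximal.
Qed.
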